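(* A theory $U$ is polyglot iff $U$ locally tolerates the theory ${\sf Q}$ plus all true $\Pi^0_1$-sentences.
   Context: Theories are first-order theories in finite signature; interpretations may be multi-dimensional and piecewise; $W\rhd D$ means $W$ interprets $D$. ${\sf Q}$ is Robinson Arithmetic. For a $U$-sentence $B$, $B$ is a pro-interpreter of $A$ over $U$ if $(U+B)\rhd A$. $U$ is polyglot iff for every consistent finitely axiomatised $A$ there is a pro-interpreter $B$ of $A$ over $U$ with $U+B$ consistent. For a finitely axiomatised $A$, $E_A$ is the conjunction of the identity axioms for the signature of $A$ together with $\exists x\,x=x$. $U$ locally tolerates $V$ iff for every finite subtheory $A$ of $V$ there is a translation $\tau$ from the language of $A$ into that of $U$ with $U+(E_A\wedge A)^\tau$ consistent. *)

(* Defs.v *)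
From HB Require Import structures.
From mathcomp Require Import all_boot.
From Stdlib Require List.

Set Implicit Arguments.
Unset Strict Implicit.
Unset Printing Implicit Defensive.

(** * First-order logic with identity over finite signatures *)

Record signature := Signature {
  fn : finType;
  rl : finType;
  far : fn -> nat;
  rar : rl -> nat
}.

Section Syntax.
Variable S : signature.

Inductive term :=
| Var (x : nat)
| App (f : fn S) (ts : {ffun 'I_(far f) -> term}).

(** De Bruijn indices; identity is a logical symbol, and the remaining
    connectives are the usual classical abbreviations. *)
Inductive form :=
| Bot
| Eq (t u : term)
| Rel (R : rl S) (ts : {ffun 'I_(rar R) -> term})
| Imp (p q : form)
| All (p : form).

Definition Not p := Imp p Bot.
Definition And p q := Not (Imp p (Not q)).
Definition Ex p := Not (All (Not p)).
Definition bigAnd (ps : seq form) := foldr And (Not Bot) ps.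
Definition Alls n p := iter n All p.
Definition Exs n p := iter n Ex p.

Fixpoint tsubst (s : nat -> term) t :=
  match t with
  | Var x => s x
  | App f ts => App [ffun i => tsubst s (ts i)]
  end.

Definition tshift := tsubst (fun x => Var x.+1).

Definition up (s : nat -> term) x := if x is y.+1 then tshift (s y) else Var 0.

Fixpoint subst (s : nat -> term) p :=
  match p with
  | Bot => Bot
  | Eq t u => Eq (tsubst s t) (tsubst s u)
  | Rel R ts => Rel [ffun i => tsubst s (ts i)]
  | Imp p q => Imp (subst s p) (subst s q)
  | All p => All (subst (up s) p)
  end.

Definition shift := subst (fun x => Var x.+1).
Definition subst0 t := subst (fun x => if x is y.+1 then Var y else t).

(** [p] with its free variables [0, 1, ..] replaced by the variables [xs]. *)
Definition inst (p : form) (xs : seq nat) := subst (fun j => Var (nth 0 xs j)) p.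

Fixpoint tbelow n t :=
  match t with
  | Var x => x < n
  | App f ts => [forall i, tbelow n (ts i)]
  end.

(** All free variables of the formula are [< n]. *)
Fixpoint below n p :=
  match p with
  | Bot => true
  | Eq t u => tbelow n t && tbelow n u
  | Rel R ts => [forall i, tbelow n (ts i)]
  | Imp p q => below n p && below n q
  | All p => below n.+1 p
  end.

Definition sentence p := below 0 p.

(** Classical natural deduction.  Free variables always denote, so that
    [Ex (Eq (Var 0) (Var 0))] is derivable in every signature. *)
Inductive derivable : seq form -> form -> Prop :=
| d_ax G p : List.In p G -> derivable G p
| d_impI G p q : derivable (p :: G) q -> derivable G (Imp p q)
| d_impE G p q : derivable G (Imp p q) -> derivable G p -> derivable G q
| d_allI G p : derivable (map shift G) p -> derivable G (All p)
| d_allE G p t : derivable G (All p) -> derivable G (subst0 t p)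
| d_raa G p : derivable (Not p :: G) Bot -> derivable G p
| d_refl G t : derivable G (Eq t t)
| d_leibniz G p t u :
    derivable G (Eq t u) -> derivable G (subst0 t p) -> derivable G (subst0 u p).

(** A theory is given by an arbitrary set of axioms, which are sentences
    whenever [is_theory] holds. *)
Definition theory := form -> Prop.

Definition is_theory (T : theory) := forall p, T p -> sentence p.

Definition proves (T : theory) p :=
  exists2 G, (forall q, List.In q G -> T q) & derivable G p.

Definition consistent (T : theory) := ~ proves T Bot.

Definition extend (T : theory) p : theory := fun q => T q \/ q = p.

Definition finitely_axiomatised (A : seq form) : theory := fun p => List.In p A.

End Syntax.

Arguments Var {S}.
Arguments Bot {S}.

(** * Removing function symbols

    Translations act on relational languages, so each [n]-ary function symbol
    is first replaced by an [n.+1]-ary symbol for its graph. *)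

Definition graph_sig (S : signature) : signature :=
  @Signature void (fn S + rl S)%type (fun f => match f with end)
    (fun R => match R with inl f => (far f).+1 | inr R => rar R end).

Definition relv (S : signature) (R : rl S) (xs : seq nat) : form S :=
  Rel [ffun i : 'I_(rar R) => Var (nth 0 xs i)].

(** "The value of [t] is the variable [y]", where [s] says where the variables
    of [t] are found in the current context. *)
Fixpoint value (S : signature) (s : nat -> nat) (y : nat) (t : term S) :
    form (graph_sig S) :=
  match t with
  | Var x => Eq (Var (s x)) (Var y)
  | App f ts =>
      let n := far f in
      Exs n (And
        (bigAnd [seq value (fun x => n + s x) (val i) (ts i) | i <- enum 'I_n])
        (relv (inl f : rl (graph_sig S)) (rcons (iota 0 n) (n + y))))
  end.

Fixpoint unravel (S : signature) (p : form S) : form (graph_sig S) :=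
  match p with
  | Bot => Bot
  | Eq t u => Ex (And (value succn 0 t) (value succn 0 u))
  | Rel R ts =>
      let n := rar R in
      Exs n (And
        (bigAnd [seq value (addn n) (val i) (ts i) | i <- enum 'I_n])
        (relv (inr R : rl (graph_sig S)) (iota 0 n)))
  | Imp p q => Imp (unravel p) (unravel q)
  | All p => All (unravel p)
  end.

Section IdentityAxioms.
Variable S : signature.
Let G := graph_sig S.

Definition eqv x y : form G := Eq (Var x) (Var y).

Definition congruence (R : rl G) : form G :=
  let n := rar R in
  Alls (n + n)
    (Imp (bigAnd [seq eqv i (n + i) | i <- iota 0 n])
         (Imp (relv R (iota 0 n)) (relv R (iota n n)))).

Definition total (f : fn S) : form G :=
  let n := far f in
  Alls n (Ex (relv (inl f : rl G) (rcons (iota 1 n) 0))).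

Definition functional (f : fn S) : form G :=
  let n := far f in
  Alls n.+2 (Imp (relv (inl f : rl G) (rcons (iota 2 n) 0))
            (Imp (relv (inl f : rl G) (rcons (iota 2 n) 1)) (eqv 0 1))).

(** The sentence [E_A] for [A] of signature [S].  The clauses [total] and
    [functional] are the identity facts that are implicit in the use of a
    function symbol; they are absent when [S] is relational. *)
Definition identity_axioms : form G :=
  bigAnd (
    [:: All (eqv 0 0);
        Alls 2 (Imp (eqv 0 1) (eqv 1 0));
        Alls 3 (Imp (eqv 0 1) (Imp (eqv 1 2) (eqv 0 2)));
        Ex (eqv 0 0)]
    ++ [seq congruence R | R <- enum (rl G)]
    ++ [seq total f | f <- enum (fn S)]
    ++ [seq functional f | f <- enum (fn S)]).

End IdentityAxioms.

(** * Multi-dimensional piecewise translations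

    There is a finite nonempty set of pieces, piece [i] consisting of
    [dim i]-tuples satisfying [dom i].  The [below] conditions exclude
    parameters. *)

Record translation (S T : signature) := Translation {
  piece : finType;
  piece0 : piece;
  dim : piece -> nat;
  dom : piece -> form T;
  eqt : piece -> piece -> form T;
  relt : forall R : rl (graph_sig S), {ffun 'I_(rar R) -> piece} -> form T;
  dom_below : forall i, below (dim i) (dom i);
  eqt_below : forall i j, below (dim i + dim j) (eqt i j);
  relt_below : forall R (c : {ffun 'I_(rar R) -> piece}), below (\sum_(j < rar R) dim (c j)) (@relt R c)
}.

Section Translate.
Variables (S T : signature) (tau : translation S T).

(** An object of the interpreted language is represented by a piece and a block
    of variables of the interpreting language. *)
Definition object : Type := piece tau * seq nat.

Definition push (i : piece tau) (r : nat -> object) (x : nat) : object :=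
  if x is y.+1 then ((r y).1, map (addn (dim i)) (r y).2)
  else (i, iota 0 (dim i)).

Definition lookup (r : nat -> object) (t : term (graph_sig S)) : object :=
  match t with
  | Var x => r x
  | App f _ => match f with end
  end.

Fixpoint translate_open (r : nat -> object) (p : form (graph_sig S)) : form T :=
  match p with
  | Bot => Bot
  | Eq t u =>
      let a := lookup r t in let b := lookup r u in
      inst (eqt a.1 b.1) (a.2 ++ b.2)
  | Rel R ts =>
      inst (relt [ffun j => (lookup r (ts j)).1])
           (flatten [seq (lookup r (ts j)).2 | j <- enum 'I_(rar R)])
  | Imp p q => Imp (translate_open r p) (translate_open r q)
  | All p =>
      bigAnd [seq Alls (dim i) (Imp (dom i) (translate_open (push i r) p))
             | i <- enum (piece tau)]
  end.

(** For sentences, the initial assignment is irrelevant. *)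
Definition translate (p : form (graph_sig S)) : form T :=
  translate_open (fun _ => (piece0 tau, nseq (dim (piece0 tau)) 0)) p.

End Translate.

(** [interprets W D] is the relation W |> D. *)
Definition interprets (T S : signature) (W : theory T) (D : theory S) : Prop :=
  exists tau : translation S T,
    proves W (translate tau (identity_axioms S)) /\
    forall p, sentence p -> proves D p -> proves W (translate tau (unravel p)).

Definition pro_interpreter (T S : signature) (U : theory T) (A : seq (form S))
    (B : form T) : Prop :=
  sentence B /\ interprets (extend U B) (finitely_axiomatised A).

Definition polyglot (T : signature) (U : theory T) : Prop :=
  forall (S : signature) (A : seq (form S)),
    is_theory (finitely_axiomatised A) ->
    consistent (finitely_axiomatised A) ->
    exists B : form T, pro_interpreter U A B /\ consistent (extend U B).

Definition locally_tolerates (T S : signature) (U : theory T) (V : theory S) :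
    Prop :=
  forall A : seq (form S),
    is_theory (finitely_axiomatised A) ->
    (forall p, List.In p A -> proves V p) ->
    exists tau : translation S T,
      consistent (extend U
        (translate tau (And (identity_axioms S) (unravel (bigAnd A))))).

(** * Robinson Arithmetic and true [Pi^0_1]-sentences *)

Inductive arith_fn := Zero | Succ | Plus | Times.

Definition arith_fn_code (f : arith_fn) : nat :=
  match f with Zero => 0 | Succ => 1 | Plus => 2 | Times => 3 end.

Definition arith_fn_decode (n : nat) : option arith_fn :=
  nth None [:: Some Zero; Some Succ; Some Plus; Some Times] n.

Lemma arith_fn_codeK : pcancel arith_fn_code arith_fn_decode.
Proof. by case. Qed.

HB.instance Definition _ := Countable.copy arith_fn (pcan_type arith_fn_codeK).

Lemma arith_fn_enumP : Finite.axiom [:: Zero; Succ; Plus; Times].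
Proof. by case. Qed.

HB.instance Definition _ := isFinite.Build arith_fn arith_fn_enumP.

Definition arith : signature :=
  @Signature arith_fn void
    (fun f => match f with Zero => 0 | Succ => 1 | Plus => 2 | Times => 2 end)
    (fun R => match R with end).

Definition arith_app (f : arith_fn) (ts : seq (term arith)) : term arith :=
  @App arith f [ffun i => nth (Var 0) ts (val i)].

Definition tzero := arith_app Zero [::].
Definition tsucc t := arith_app Succ [:: t].
Definition tplus t u := arith_app Plus [:: t; u].
Definition ttimes t u := arith_app Times [:: t; u].

Definition Q_axioms : seq (form arith) :=
  let x := Var 1 in let y := Var 0 in
  [:: Alls 1 (Not (Eq (tsucc y) tzero));
      Alls 2 (Imp (Eq (tsucc x) (tsucc y)) (Eq x y));
      Alls 1 (Imp (Not (Eq (Var 0) tzero)) (Ex (Eq (Var 1) (tsucc (Var 0)))));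
      Alls 1 (Eq (tplus y tzero) y);
      Alls 2 (Eq (tplus x (tsucc y)) (tsucc (tplus x y)));
      Alls 1 (Eq (ttimes y tzero) tzero);
      Alls 2 (Eq (ttimes x (tsucc y)) (tplus (ttimes x y) x))].

Definition Q : theory arith := finitely_axiomatised Q_axioms.

Definition Le (t u : term arith) : form arith :=
  Ex (Eq (tplus (Var 0) (tshift t)) (tshift u)).

(** Bounded existential quantifiers are obtained as [Not (Ball t (Not p))]; the
    bound [tshift t] does not contain the quantified variable. *)
Definition Ball (t : term arith) (p : form arith) : form arith :=
  All (Imp (Le (Var 0) (tshift t)) p).

Inductive Delta0 : form arith -> Prop :=
| Delta0_Bot : Delta0 Bot
| Delta0_Eq t u : Delta0 (Eq t u)
| Delta0_Imp p q : Delta0 p -> Delta0 q -> Delta0 (Imp p q)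
| Delta0_Ball t p : Delta0 p -> Delta0 (Ball t p).

Inductive Pi1 : form arith -> Prop :=
| Pi1_Delta0 p : Delta0 p -> Pi1 p
| Pi1_All p : Pi1 p -> Pi1 (All p).

Definition arith_op (f : arith_fn) : ('I_(far (f : fn arith)) -> nat) -> nat :=
  match f with
  | Zero => fun=> 0
  | Succ => fun a => (a ord0).+1
  | Plus => fun a => a ord0 + a ord_max
  | Times => fun a => a ord0 * a ord_max
  end.

Fixpoint eval (e : nat -> nat) (t : term arith) : nat :=
  match t with
  | Var x => e x
  | App f ts => arith_op (fun i => eval e (ts i))
  end.

(** Satisfaction in the standard model. *)
Fixpoint holds (e : nat -> nat) (p : form arith) : Prop :=
  match p with
  | Bot => False
  | Eq t u => eval e t = eval e u
  | Rel R _ => match R with end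
  | Imp p q => holds e p -> holds e q
  | All p => forall n, holds (fun x => if x is y.+1 then e y else n) p
  end.

Definition true_Pi1 : theory arith := fun p =>
  [/\ sentence p, Pi1 p & forall e, holds e p].

Definition Q_true_Pi1 : theory arith := fun p => Q p \/ true_Pi1 p.

(* Main.v *)
(** By soundness in the standard model every finite part [A] of [Q] plus the true
    [Pi1]-sentences is consistent, so a pro-interpreter of [A] exists if [U] is
    polyglot, and its translation of [A] is consistent with [U].

    Conversely, let [A] be finitely axiomatised and consistent, and let [N] be a
    model of it.  The statement "the subformula [p] of [A] holds of [xs]" is coded
    by a number, using a quadratic pairing polynomial, and the Henkin witness for
    a failure of [All p] at [xs] is taken to be the code of the pair
    [(All p, xs)].  Thus the terms of the Henkin model are numbers, and its theory
    becomes a set of numbers that satisfies finitely many clauses, universally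
    quantified over numbers; [N] provides such a set.  Hence it is a true
    [Pi1]-sentence that, if there is room to code the subsets of [[0, n]] by
    divisibility, then one of these codes satisfies the clauses up to [n].
    In a model of [Q], of this sentence and of the semiring identities, the
    leftmost branch of the tree of such codes is definable on a definable cut,
    without any induction in the model.  Solovay's shortening makes the cut closed
    under addition and multiplication, that is, under the Henkin witnesses, so
    that it becomes the domain of a definable model of [A].  All of this is done
    inside models of [U] extended by the translated arithmetic, and the
    completeness theorem turns it into an interpretation. *)

From mathcomp Require Import all_boot.
From Stdlib Require Import Ring Classical ClassicalEpsilon.
From Stdlib Require Import FunctionalExtensionality PropExtensionality.
Require Import Defs.

Set Implicit Arguments.
Unset Strict Implicit.
Unset Printing Implicit Defensive.

(** The difficulty is uniformity. In a nonstandard model the main sentence yields, for each [n] with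
    room, some code that satisfies the clauses up to [n]; but codes for different [n] need not
    agree, and nothing provides one code for a whole cut. A branch must therefore be singled out by
    a formula, and the existence and uniqueness of its levels, which would call for induction, are
    made part of the definition of a cut. Room is a hypothesis of the main sentence because [Q] does
    not prove that it exists; the common multiple that it contains also bounds the code, which keeps
    the sentence [Pi1]. On a cut, room is recovered by adding one factor at a time. The order of the
    model is not assumed to be linear, so common upper bounds are sums; this is why the cut of
    lengths is closed under addition before branches are considered. Shortening does not in general
    give closure under exponentiation, so pairing has to be a polynomial. *)

Definition scons A (a : A) (e : nat -> A) x := if x is y.+1 then e y else a.

(** * Substitution *)

Section Substitution.
Variable S : signature.
Implicit Types (s r : nat -> term S) (t : term S) (p q : form S).

(** The arguments of [App] sit inside a finite function, so the induction hypothesis for them is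
    stated explicitly. *)
Fixpoint term_ffun_ind (P : term S -> Prop) (hV : forall x, P (Var x))
    (hA : forall f (ts : {ffun 'I_(far f) -> term S}),
       (forall i, P (ts i)) -> P (App ts)) t : P t :=
  match t with
  | Var x => hV x
  | App f ts => hA f ts (fun i => term_ffun_ind hV hA (ts i))
  end.

Lemma tsubst_ext s r t : s =1 r -> tsubst s t = tsubst r t.
Proof.
move=> sr; elim/term_ffun_ind: t => [x|f ts IH] /=; first exact: sr.
by congr App; apply/ffunP=> i; rewrite !ffunE.
Qed.

Lemma up_ext s r : s =1 r -> up s =1 up r.
Proof. by move=> sr [|x] //=; rewrite sr. Qed.

Lemma subst_ext s r p : s =1 r -> subst s p = subst r p.
Proof.
elim: p s r => [|t u|R ts|p IHp q IHq|p IH] s r sr //=.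
- by rewrite !(tsubst_ext _ sr).
- by congr Rel; apply/ffunP=> i; rewrite !ffunE (tsubst_ext _ sr).
- by rewrite (IHp _ _ sr) (IHq _ _ sr).
- by rewrite (IH _ _ (up_ext sr)).
Qed.

Lemma tsubst_id s t : s =1 Var -> tsubst s t = t.
Proof.
move=> sV; elim/term_ffun_ind: t => [x|f ts IH] /=; first exact: sV.
by congr App; apply/ffunP=> i; rewrite !ffunE.
Qed.

Lemma subst_id s p : s =1 Var -> subst s p = p.
Proof.
elim: p s => [|t u|R ts|p IHp q IHq|p IH] s sV //=.
- by rewrite !tsubst_id.
- by congr Rel; apply/ffunP=> i; rewrite !ffunE tsubst_id.
- by rewrite IHp ?IHq.
- by rewrite IH // => -[|x] //=; rewrite sV.
Qed.

Lemma tsubst_comp s r t : tsubst s (tsubst r t) = tsubst (fun x => tsubst s (r x)) t.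
Proof.
elim/term_ffun_ind: t => [x|f ts IH] //=.
by congr App; apply/ffunP=> i; rewrite !ffunE.
Qed.

Lemma subst_comp s r p : subst s (subst r p) = subst (fun x => tsubst s (r x)) p.
Proof.
elim: p s r => [|t u|R ts|p IHp q IHq|p IH] s r //=.
- by rewrite !tsubst_comp.
- by congr Rel; apply/ffunP=> i; rewrite !ffunE tsubst_comp.
- by rewrite IHp IHq.
- congr All; rewrite IH; apply: subst_ext => -[|x] //=.
  by rewrite /tshift !tsubst_comp.
Qed.

Lemma subst0E t s p : subst0 t (subst (up s) p) = subst (scons t s) p.
Proof.
rewrite /subst0 subst_comp; apply: subst_ext => -[|x] //=.
by rewrite /tshift tsubst_comp tsubst_id.
Qed.

Lemma subst_subst0 s t p : subst s (subst0 t p) = subst0 (tsubst s t) (subst (up s) p).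
Proof. by rewrite subst0E /subst0 subst_comp; apply: subst_ext => -[|x]. Qed.

Lemma subst_shift s p : subst (up s) (shift p) = shift (subst s p).
Proof. by rewrite /shift !subst_comp; apply: subst_ext. Qed.

Lemma tbelow_leq m n t : m <= n -> tbelow m t -> tbelow n t.
Proof.
move=> mn; elim/term_ffun_ind: t => [x|f ts IH] /=; first by move/leq_trans; apply.
by move/forallP=> h; apply/forallP=> i; apply: IH.
Qed.

Lemma below_leq m n p : m <= n -> below m p -> below n p.
Proof.
elim: p m n => [|t u|R ts|p IHp q IHq|p IH] m n mn //=.
- by move=> /andP[ht hu]; rewrite !(tbelow_leq mn).
- by move/forallP=> h; apply/forallP=> i; apply: tbelow_leq (h i).
- by move=> /andP[/(IHp _ _ mn) -> /(IHq _ _ mn) ->].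
- exact: IH.
Qed.

Fixpoint tbound t :=
  match t with
  | Var x => x.+1
  | App f ts => \max_(i < far f) tbound (ts i)
  end.

Lemma tbelow_tbound t : tbelow (tbound t) t.
Proof.
elim/term_ffun_ind: t => [x|f ts IH] //=.
by apply/forallP=> i; apply: tbelow_leq (IH i); apply: leq_bigmax.
Qed.

Lemma below_exists p : exists n, below n p.
Proof.
elim: p => [|t u|R ts|p [m Hp] q [n Hq]|p [n Hp]] /=.
- by exists 0.
- exists (maxn (tbound t) (tbound u)).
  by rewrite (tbelow_leq (leq_maxl _ _) (tbelow_tbound t))
    (tbelow_leq (leq_maxr _ _) (tbelow_tbound u)).
- exists (\max_(i < rar R) tbound (ts i)); apply/forallP=> i.
  by apply: tbelow_leq (tbelow_tbound _); apply: leq_bigmax.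
- exists (maxn m n).
  by rewrite (below_leq (leq_maxl _ _) Hp) (below_leq (leq_maxr _ _) Hq).
- by exists n; apply: below_leq Hp.
Qed.

Lemma tsubst_ext_below n s r t :
  tbelow n t -> (forall x, x < n -> s x = r x) -> tsubst s t = tsubst r t.
Proof.
move=> + sr; elim/term_ffun_ind: t => [x|f ts IH] /=; first exact: sr.
by move/forallP=> h; congr App; apply/ffunP=> i; rewrite !ffunE IH.
Qed.

Lemma subst_ext_below n s r p :
  below n p -> (forall x, x < n -> s x = r x) -> subst s p = subst r p.
Proof.
elim: p n s r => [|t u|R ts|p IHp q IHq|p IH] n s r //=.
- by move=> /andP[ht hu] sr; rewrite !(@tsubst_ext_below n s r).
- move/forallP=> h sr; congr Rel; apply/ffunP=> i.
  by rewrite !ffunE (@tsubst_ext_below n s r).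
- by move=> /andP[hp hq] sr; rewrite (IHp n s r) ?(IHq n s r).
- by move=> h sr; congr All; apply: (IH n.+1) => // -[|x] //= xn; rewrite sr.
Qed.

Lemma tbelow_tsubst m n s t :
  tbelow n t -> (forall x, x < n -> tbelow m (s x)) -> tbelow m (tsubst s t).
Proof.
move=> + hs; elim/term_ffun_ind: t => [x|f ts IH] /=; first exact: hs.
by move/forallP=> h; apply/forallP=> i; rewrite ffunE IH.
Qed.

Lemma below_subst m n s p :
  below n p -> (forall x, x < n -> tbelow m (s x)) -> below m (subst s p).
Proof.
elim: p m n s => [|t u|R ts|p IHp q IHq|p IH] m n s //=.
- by move=> /andP[ht hu] hs; rewrite !(@tbelow_tsubst m n).
- move/forallP=> h hs; apply/forallP=> i.
  by rewrite ffunE (@tbelow_tsubst m n).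
- by move=> /andP[hp hq] hs; rewrite (IHp m n) ?(IHq m n).
- move=> h hs; apply: (IH _ n.+1) => // -[|x] //= xn.
  by apply: (tbelow_tsubst (hs _ xn)).
Qed.

End Substitution.

(** * Derivability *)

Section Derivability.
Variable S : signature.
Implicit Types (G H : seq (form S)) (p q : form S) (U : theory S).

Lemma derivable_weaken G H p :
  (forall q, List.In q G -> List.In q H) -> derivable G p -> derivable H p.
Proof.
move=> sub d; elim: d H sub => {G p}.
- by move=> G p Gp H sub; apply/d_ax/sub.
- move=> G p q _ IH H sub; apply/d_impI/IH => r /= [->|/sub]; tauto.
- by move=> G p q _ IH1 _ IH2 H sub; apply: d_impE (IH1 _ sub) (IH2 _ sub).
- move=> G p _ IH H sub; apply/d_allI/IH => r /List.in_map_iff[q [<- /sub Hq]].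
  exact: List.in_map.
- by move=> G p t _ IH H sub; apply/d_allE/IH.
- move=> G p _ IH H sub; apply/d_raa/IH => r /= [->|/sub]; tauto.
- by move=> G t H _; apply: d_refl.
- by move=> G p t u _ IH1 _ IH2 H sub; apply: d_leibniz (IH1 _ sub) (IH2 _ sub).
Qed.

Lemma derivable_subst G p s :
  derivable G p -> derivable (map (subst s) G) (subst s p).
Proof.
move=> d; elim: d s => {G p} /=.
- by move=> G p Gp s; apply/d_ax/List.in_map.
- by move=> G p q _ IH s; apply/d_impI/IH.
- by move=> G p q _ IH1 _ IH2 s; apply: d_impE (IH1 s) (IH2 s).
- move=> G p _ IH s; apply: d_allI; move: (IH (up s)).
  by rewrite -!map_comp; under eq_map => q do rewrite /= subst_shift.
- by move=> G p t _ IH s; rewrite subst_subst0; apply/d_allE/IH.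
- by move=> G p _ IH s; apply/d_raa/IH.
- by move=> G t s; apply: d_refl.
- move=> G p t u _ IH1 _ IH2 s; move: (IH2 s); rewrite !subst_subst0.
  exact: d_leibniz (IH1 s).
Qed.

(** The eigenvariable condition in de Bruijn form. The substitution [s] turns the free variable [c]
    into the bound variable 0 and shifts the others, so it undoes the instantiation of [p] and acts
    on [G] as [shift]. *)
Lemma derivable_fresh G p c :
  (forall q, List.In q G -> below c q) -> below c.+1 p ->
  derivable G (subst0 (Var c) p) -> derivable G (All p).
Proof.
move=> hG hp /(@derivable_subst _ _ (fun x => if x == c then Var 0 else Var x.+1)).
set s := (fun x => _) => d; apply: d_allI.
have -> : p = subst s (subst0 (Var c) p).
  rewrite /subst0 subst_comp -[LHS](@subst_id _ Var) //.
  apply: (subst_ext_below hp) => -[|x] xc /=; first by rewrite /s eqxx.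
  by rewrite /s ltn_eqF.
apply: derivable_weaken d => q /List.in_map_iff[r [<- Hr]].
apply/List.in_map_iff; exists r; split=> //.
apply: (subst_ext_below (hG _ Hr)) => x xc.
by rewrite /s ltn_eqF.
Qed.

Lemma proves_mono U V p : (forall q, U q -> V q) -> proves U p -> proves V p.
Proof. by move=> UV [G GU d]; exists G => // q /GU/UV. Qed.

Lemma proves_ax U p : U p -> proves U p.
Proof. by move=> Up; exists [:: p] => [q [<-|]|] //; apply: d_ax; left. Qed.

Lemma proves_impE U p q : proves U (Imp p q) -> proves U p -> proves U q.
Proof.
move=> [G GU d] [H HU d']; exists (G ++ H).
  by move=> r /List.in_app_iff[/GU|/HU].
apply: (@d_impE _ _ p); [apply: derivable_weaken d | apply: derivable_weaken d'];
  move=> r Hr; apply/List.in_app_iff; tauto.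
Qed.

Lemma proves_impI U p q : proves (extend U p) q -> proves U (Imp p q).
Proof.
case=> G GU d.
suff [H HU sub] : exists2 H, (forall r, List.In r H -> U r) &
    forall r, List.In r G -> List.In r (p :: H).
  by exists H => //; apply/d_impI/derivable_weaken/d.
elim: G GU {d} => [|r G IH] GU; first by exists [::].
have [|H HU sub] := IH; first by move=> r' h; apply: GU; right.
have [Ur|->] := GU r (or_introl erefl).
  exists (r :: H) => r' /= [<-|] //; first exact: HU.
  - by right; left.
  - by move/sub => /= -[->|]; tauto.
by exists H => // r' /= [<-|/sub //]; left.
Qed.

Lemma proves_raa U p : proves (extend U (Not p)) Bot -> proves U p.
Proof.
move/proves_impI => [G GU d]; exists G => //; apply/d_raa.
apply: (@d_impE _ _ (Not p)); last by apply: d_ax; left.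
by apply: derivable_weaken d => q; right.
Qed.

Lemma proves_gen U p c :
  (forall q, U q -> below c q) -> below c.+1 p ->
  proves U (subst0 (Var c) p) -> proves U (All p).
Proof.
move=> hU hp [G GU d]; exists G => //.
by apply: derivable_fresh d => // q /GU/hU.
Qed.

Lemma proves_allE U p t : proves U (All p) -> proves U (subst0 t p).
Proof. by move=> [G GU d]; exists G => //; apply: d_allE. Qed.

Lemma proves_leibniz U p t u :
  proves U (Eq t u) -> proves U (subst0 t p) -> proves U (subst0 u p).
Proof.
move=> [G GU d] [H HU d']; exists (G ++ H).
  by move=> r /List.in_app_iff[/GU|/HU].
apply: (@d_leibniz _ _ _ t); [apply: derivable_weaken d | apply: derivable_weaken d'];
  move=> r Hr; apply/List.in_app_iff; tauto.
Qed.

End Derivability.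

(** * Structures *)

(* Functions and relations take sequences of arguments; their values on
   sequences whose length is not the arity are irrelevant.  The symbol for
   identity is interpreted by an arbitrary relation, as is needed for the
   structures that are defined by translations. *)
Record structure (S : signature) := Structure {
  carrier :> Type;
  fnI : fn S -> seq carrier -> carrier;
  rlI : rl S -> seq carrier -> Prop;
  eqI : carrier -> carrier -> Prop
}.

Definition normal S (M : structure S) := forall x y : M, eqI x y <-> x = y.

Section Satisfaction.
Variables (S : signature) (M : structure S).
Implicit Types (e : nat -> M) (p q : form S).

Fixpoint teval e (t : term S) : M :=
  match t with
  | Var x => e x
  | App f ts => fnI f [seq teval e (ts i) | i <- enum 'I_(far f)]
  end.

Fixpoint sat e (p : form S) : Prop :=
  match p with
  | Bot => False
  | Eq t u => eqI (teval e t) (teval e u)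
  | Rel R ts => rlI R [seq teval e (ts i) | i <- enum 'I_(rar R)]
  | Imp p q => sat e p -> sat e q
  | All p => forall x, sat (scons x e) p
  end.

Definition models (T : theory S) := forall p, T p -> forall e, sat e p.

Lemma teval_ext e e' t : e =1 e' -> teval e t = teval e' t.
Proof.
move=> ee'; elim/term_ffun_ind: t => [x|f ts IH] /=; first exact: ee'.
by congr fnI; apply: eq_map.
Qed.

Lemma teval_ext_below n e e' t :
  tbelow n t -> (forall x, x < n -> e x = e' x) -> teval e t = teval e' t.
Proof.
move=> + ee'; elim/term_ffun_ind: t => [x|f ts IH] /=; first exact: ee'.
by move/forallP=> h; congr fnI; apply: eq_map => i; apply: IH.
Qed.

Lemma sat_ext_below n e e' p :
  below n p -> (forall x, x < n -> e x = e' x) -> sat e p <-> sat e' p.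
Proof.
elim: p n e e' => [|t u|R ts|p IHp q IHq|p IH] n e e' //=.
- by move=> /andP[ht hu] ee'; rewrite !(@teval_ext_below n e e').
- move/forallP=> h ee'; rewrite (@eq_map _ _ _ (fun i => teval e' (ts i))) // => i.
  exact: teval_ext_below ee'.
- by move=> /andP[hp hq] ee'; rewrite (IHp n e e') // (IHq n e e').
- move=> h ee'; have H x : sat (scons x e) p <-> sat (scons x e') p.
    by apply: (IH n.+1) => // -[|y] //= yn; rewrite ee'.
  by split=> hx x; apply/H.
Qed.

Lemma sat_ext e e' p : e =1 e' -> sat e p <-> sat e' p.
Proof. by move=> ee'; have [n hn] := below_exists p; apply: sat_ext_below hn _. Qed.

Lemma teval_tsubst e s t : teval e (tsubst s t) = teval (fun x => teval e (s x)) t.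
Proof.
elim/term_ffun_ind: t => [x|f ts IH] //=.
by congr fnI; apply: eq_map => i; rewrite ffunE.
Qed.

Lemma teval_tshift x e t : teval (scons x e) (tshift t) = teval e t.
Proof. by rewrite /tshift teval_tsubst. Qed.

Lemma sat_subst e s p : sat e (subst s p) <-> sat (fun x => teval e (s x)) p.
Proof.
elim: p e s => [|t u|R ts|p IHp q IHq|p IH] e s //=.
- by rewrite !teval_tsubst.
- rewrite (@eq_map _ _ _ (fun i => teval (fun x => teval e (s x)) (ts i))) // => i.
  by rewrite ffunE teval_tsubst.
- by rewrite IHp IHq.
- have H x : sat (scons x e) (subst (up s) p) <->
      sat (scons x (fun x => teval e (s x))) p.
    by rewrite IH; apply: sat_ext => -[|y] //=; rewrite teval_tshift.
  by split=> hx x; apply/H.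
Qed.

Lemma sat_inst e xs p : sat e (inst p xs) <-> sat (fun j => e (nth 0 xs j)) p.
Proof. exact: sat_subst. Qed.

Lemma sat_Not e p : sat e (Not p) <-> ~ sat e p.
Proof. by []. Qed.

Lemma sat_And e p q : sat e (And p q) <-> sat e p /\ sat e q.
Proof. by split=> [/=|/=]; [move=> h; split; apply: NNPP|]; tauto. Qed.

Lemma sat_Ex e p : sat e (Ex p) <-> exists x, sat (scons x e) p.
Proof.
split=> /= [h|[x hx] h]; last exact: h hx.
by apply: NNPP => n; apply: h => x hx; apply: n; exists x.
Qed.

Lemma sat_bigAnd e (ps : seq (form S)) :
  sat e (bigAnd ps) <-> forall p, List.In p ps -> sat e p.
Proof.
elim: ps => [|p ps IH]; first by split=> [_ p []|_ ].
rewrite [bigAnd _]/(And p (bigAnd ps)) sat_And IH; split.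
  by move=> [h1 h2] q /= [<-|/h2].
by move=> h; split=> [|q hq]; apply: h; [left|right].
Qed.

(* The outermost of [n] quantifiers binds the variable [n.-1]. *)
Definition env_cat (xs : seq M) e j := nth (e (j - size xs)) xs j.

Lemma env_cat_rcons xs x e : env_cat (rcons xs x) e =1 env_cat xs (scons x e).
Proof.
move=> j; rewrite /env_cat nth_rcons size_rcons.
case: ltngtP => [h|h|->]; first exact: set_nth_default.
  by rewrite [RHS]nth_default ?(ltnW h) // subnS; move: h; rewrite -subn_gt0; case: (j - size xs).
by rewrite nth_default // subnn.
Qed.

Lemma sat_Alls n e p :
  sat e (Alls n p) <-> forall xs, size xs = n -> sat (env_cat xs e) p.
Proof.
elim: n e => [|n IH] e /=.
  have E : env_cat [::] e =1 e by move=> j; rewrite /env_cat nth_nil subn0.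
  split=> [h xs /size0nil ->|/(_ [::] erefl)]; first exact/(sat_ext _ E).
  by move/(sat_ext _ E).
split=> [h xs|h x].
  case/lastP: xs => // xs x; rewrite size_rcons => -[sz].
  by apply/(sat_ext _ (env_cat_rcons _ _ _)); move: xs sz; apply/IH.
apply/IH => xs sz; apply/(sat_ext _ (env_cat_rcons _ _ _)).
by apply: h; rewrite size_rcons sz.
Qed.

Lemma sat_Exs n e p :
  sat e (Exs n p) <-> exists2 xs, size xs = n & sat (env_cat xs e) p.
Proof.
elim: n e => [|n IH] e.
  have E : env_cat [::] e =1 e by move=> j; rewrite /env_cat nth_nil subn0.
  split=> [h|[xs /size0nil -> /(sat_ext _ E)]] //.
  by exists [::] => //; apply/(sat_ext _ E).
rewrite [Exs _ _]/(Ex (Exs n p)) sat_Ex; split=> [[x /IH[xs sz h]]|[xs]].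
  exists (rcons xs x); first by rewrite size_rcons sz.
  exact/(sat_ext _ (env_cat_rcons _ _ _)).
case/lastP: xs => // xs x; rewrite size_rcons => -[sz] h.
by exists x; apply/IH; exists xs => //; apply/(sat_ext _ (env_cat_rcons _ _ _)).
Qed.

Lemma soundness G p e :
  normal M -> derivable G p -> (forall q, List.In q G -> sat e q) -> sat e p.
Proof.
move=> nM d; elim: d e => {G p} /=.
- by move=> G p Gp e; apply.
- by move=> G p q _ IH e h hp; apply: IH => r /= [<-|/h].
- by move=> G p q _ IH1 _ IH2 e h; apply: IH1 => //; apply: IH2.
- move=> G p _ IH e h x; apply: IH => r /List.in_map_iff[q [<- /h hq]].
  by apply/sat_subst.
- move=> G p t _ IH e h; apply/sat_subst.
  by apply: (iffLR (sat_ext p _)) (IH _ h (teval e t)) => -[].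
- move=> G p _ IH e h; apply: NNPP => n; apply: (IH e) => r /= [<-|/h] //.
- by move=> G t e _; apply/nM.
- move=> G p t u _ IH1 _ IH2 e h; apply/sat_subst.
  move/sat_subst: (IH2 _ h); apply: (iffLR (sat_ext _ _)) => -[|x] //=.
  exact/nM/IH1.
Qed.

Lemma proves_sound T p e : normal M -> models T -> proves T p -> sat e p.
Proof. by move=> nM MT [G GT d]; apply: (soundness nM d) => q /GT/MT. Qed.

End Satisfaction.

(** * Completeness *)

(** Classes are predicates of the form [E x], compared by extensionality, and [rep] picks
    representatives by choice. Both the term model and the normal structure behind a graph structure
    are obtained in this way. *)
Lemma quotient_exists (X : Type) (E : X -> X -> Prop) :
  (forall x, E x x) -> (forall x y, E x y -> E y x) ->
  (forall x y z, E x y -> E y z -> E x z) ->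
  exists (Y : Type) (pi : X -> Y) (rep : Y -> X),
    (forall y, pi (rep y) = y) /\ forall x x', pi x = pi x' <-> E x x'.
Proof.
move=> Er Es Et.
pose Y := {P : X -> Prop | exists x, P = E x}.
pose pi x : Y := exist _ (E x) (ex_intro _ x erefl).
have piE x x' : pi x = pi x' <-> E x x'.
  split=> [/(f_equal (fun y => sval y x')) /= -> //|h].
  apply: eq_sig_hprop => [P a b|]; first exact: proof_irrelevance.
  apply: functional_extensionality => z; apply: propositional_extensionality.
  by split=> /= [/(Et _ _ _ (Es _ _ h))|/(Et _ _ _ h)].
have rep_ex (y : Y) : {x | pi x = y}.
  apply: constructive_indefinite_description; case: y => P Py.
  case: (Py) => x Px; exists x.
  by apply: eq_sig_hprop => [Q a b|]; [apply: proof_irrelevance|].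
by exists Y, pi, (fun y => sval (rep_ex y)); split=> // y; case: (rep_ex y).
Qed.

(** * Numbering of formulas *)

Section Coding.
Variable S : signature.

Fixpoint tree_of_term (t : term S) : GenTree.tree nat :=
  match t with
  | Var x => GenTree.Leaf x
  | App f ts => GenTree.Node (pickle f) [seq tree_of_term (ts i) | i <- enum 'I_(far f)]
  end.

Fixpoint tree_of_form (p : form S) : GenTree.tree nat :=
  match p with
  | Bot => GenTree.Node 0 [::]
  | Eq t u => GenTree.Node 1 [:: tree_of_term t; tree_of_term u]
  | Imp p q => GenTree.Node 2 [:: tree_of_form p; tree_of_form q]
  | All p => GenTree.Node 3 [:: tree_of_form p]
  | Rel R ts => GenTree.Node (4 + pickle R) [seq tree_of_term (ts i) | i <- enum 'I_(rar R)]
  end.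

Lemma tree_of_term_inj : injective tree_of_term.
Proof.
elim/term_ffun_ind=> [x|f ts IH] [y|g us] //= => [[->]//|[/(pcan_inj pickleK) fg]].
case: g / fg us => us /eq_in_map h; congr App; apply/ffunP=> i.
by apply: IH; apply: h; rewrite mem_enum.
Qed.

Lemma tree_of_form_inj : injective tree_of_form.
Proof.
elim=> [|t u|R ts|p IHp q IHq|p IHp] [|t' u'|R' ts'|p' q'|p'] //=.
- by move=> [/tree_of_term_inj -> /tree_of_term_inj ->].
- move=> [/(pcan_inj pickleK) fg]; case: R' / fg ts' => us /eq_in_map h.
  congr Rel; apply/ffunP=> i.
  by apply: tree_of_term_inj; apply: h; rewrite mem_enum.
- by move=> [/IHp -> /IHq ->].
- by move=> [/IHp ->].
Qed.

Lemma form_code_exists : exists code : form S -> nat, injective code.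
Proof.
by exists (fun p => pickle (tree_of_form p)) => p q /(pcan_inj pickleK)/tree_of_form_inj.
Qed.

(* The code is hidden behind an existential because the numbers obtained from
   [pickle] are too large to be computed, even for small formulas. *)
Definition form_code : form S -> nat :=
  sval (constructive_indefinite_description _ form_code_exists).

Lemma form_code_inj : injective form_code.
Proof. exact: svalP. Qed.

Lemma form_enumeration : exists E : nat -> form S, forall p, exists n, E n = p.
Proof.
have h n : {q : form S | forall p, form_code p = n -> q = p}.
  apply: constructive_indefinite_description.
  have [[p <-]|no] := classic (exists p, form_code p = n).
    by exists p => q /form_code_inj.
  by exists Bot => p pn; case: no; exists p.
exists (fun n => sval (h n)) => p; exists (form_code p).
by case: (h _) => q /= /(_ _ erefl).
Qed.

End Coding.

(** * Henkin extensions and term models *)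

Section Henkin.
Variable S : signature.
Implicit Types (T : theory S) (p q : form S).

(* Variables that are not free in [T] serve as Henkin constants. *)
Definition bounded T := exists c, forall q, T q -> below c q.

Lemma bounded_extend T p : bounded T -> bounded (extend T p).
Proof.
move=> [c hc]; have [d hd] := below_exists p; exists (maxn c d) => q [/hc|->].
  by apply: below_leq; apply: leq_maxl.
by apply: below_leq hd; apply: leq_maxr.
Qed.

(** Completeness at [p] and the Henkin witness for [p] are joined in one condition, so that a single
    run through the formulas provides both. *)
Definition decides T p :=
  T p \/ T (Not p) /\ forall q, p = All q -> exists t, T (Not (subst0 t q)).

(** If adding the witness were inconsistent, [N] would prove [q] of the fresh variable [m], hence
    [All q] by generalisation, against the consistency of [N], which contains the negation of
    [All q]. *)
Lemma decide_formula T p : bounded T -> consistent T ->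
  exists T', [/\ bounded T', consistent T', (forall q, T q -> T' q) & decides T' p].
Proof.
move=> bT cT; have [con|/NNPP incon] := classic (consistent (extend T p)).
  exists (extend T p); split=> //; first exact: bounded_extend.
  - by move=> q; left.
  - by left; right.
pose N := extend T (Not p).
have bN : bounded N by apply: bounded_extend.
have cN : consistent N.
  by move=> /proves_raa; apply: contra_not cT; apply: proves_impE (proves_impI incon).
have [[q pq]|nall] := classic (exists q, p = All q); last first.
  exists N; split=> //; first by move=> q; left.
  by right; split; [right | move=> q pq; case: nall; exists q].
have [c hc] := bN; have [d hd] := below_exists q.
pose m := maxn c d; exists (extend N (Not (subst0 (Var m) q))); split.
- exact: bounded_extend.
- move=> /proves_raa h; apply: cN.
  apply: (proves_impE (p := p)); first by apply: proves_ax; right.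
  rewrite pq; apply: (proves_gen _ _ h) => [r /hc|].
    by apply: below_leq; apply: leq_maxl.
  by apply: below_leq hd; rewrite leqW ?leq_maxr.
- by move=> r; left; left.
- right; split; first by left; right.
  by move=> r; rewrite pq => -[<-]; exists (Var m); right.
Qed.

Lemma henkin_extension T : bounded T -> consistent T ->
  exists D : theory S, [/\ consistent D, (forall q, T q -> D q) & forall p, decides D p].
Proof.
move=> bT cT; have [E hE] := form_enumeration S.
pose state := {T' : theory S | bounded T' /\ consistent T'}.
have step (n : nat) (s : state) : {s' : state |
    (forall q, sval s q -> sval s' q) /\ decides (sval s') (E n)}.
  apply: constructive_indefinite_description; case: s => T' [b c].
  by have [T'' [b' c' sub dec]] := decide_formula (E n) b c; exists (exist _ T'' (conj b' c')).
pose fix chain n : state :=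
  if n is m.+1 then sval (step m (chain m)) else exist _ T (conj bT cT).
have chain_leq m n q : m <= n -> sval (chain m) q -> sval (chain n) q.
  move=> /subnK <-; elim: (n - m) => //= k IH /IH.
  by case: (step _ _) => s' /= [sub _]; apply: sub.
pose D q := exists n, sval (chain n) q.
have fin (G : seq (form S)) : (forall q, List.In q G -> D q) ->
    exists n, forall q, List.In q G -> sval (chain n) q.
  elim: G => [|p G IH] h; first by exists 0.
  have [|m hm] := IH; first by move=> q Gq; apply: h; right.
  have [n hn] := h p (or_introl erefl); exists (maxn m n) => q /= [<-|/hm].
    by apply: chain_leq hn; apply: leq_maxr.
  by apply: chain_leq; apply: leq_maxl.
exists D; split.
- by move=> [G /fin[n hn] d]; case: (svalP (chain n)) => _; apply; exists G.
- by move=> q Tq; exists 0.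
- move=> p; have [n <-] := hE p.
  have : decides (sval (chain n.+1)) (E n) by rewrite /=; case: (step _ _) => s' /= [].
  case=> [h|[h1 h2]]; [by left; exists n.+1|right]; split; first by exists n.+1.
  by move=> q /h2[t ht]; exists t, n.+1.
Qed.

Variable D : theory S.
Hypotheses (conD : consistent D) (decD : forall p, decides D p).

Lemma henkin_closed p : proves D p -> D p.
Proof.
move=> h; have [//|[h' _]] := decD p.
by case: conD; apply: proves_impE h; apply: proves_ax.
Qed.

Lemma henkin_Imp p q : D (Imp p q) <-> (D p -> D q).
Proof.
split=> [h hp|h].
  by apply: henkin_closed; apply: proves_impE; apply: proves_ax; eassumption.
apply: henkin_closed; apply: proves_impI.
have [hp|[hp _]] := decD p.
  by apply: proves_ax; left; apply: h.
apply: proves_raa; apply: (proves_impE (p := p)); apply: proves_ax.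
  by left; left.
by left; right.
Qed.

Lemma henkin_All p : D (All p) <-> forall t, D (subst0 t p).
Proof.
split=> [h t|h].
  by apply: henkin_closed; apply: proves_allE; apply: proves_ax.
have [//|[_ /(_ _ erefl)[t ht]]] := decD (All p).
by case: conD; apply: proves_impE (proves_ax ht) (proves_ax (h t)).
Qed.

(** The Leibniz rule replaces one term, so the finitely many variables of [p] are treated in turn:
    [mix k] is the assignment after [k] replacements, and [rho] leaves the place of variable [k]
    open as variable 0. *)
Lemma henkin_leibniz p s r :
  (forall x, D (Eq (s x) (r x))) -> D (subst s p) -> D (subst r p).
Proof.
move=> sr; have [n hn] := below_exists p.
pose mix k x := if x < k then r x else s x.
suff h k : D (subst s p) -> D (subst (mix k) p).
  move/(h n); rewrite (subst_ext_below (r := r) hn) // => x xn.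
  by rewrite /mix xn.
elim: k => [|k IH] // /IH.
pose rho x := if x == k then Var 0 else tshift (mix k x).
have E t : subst0 t (subst rho p) = subst (fun x => if x == k then t else mix k x) p.
  rewrite /subst0 subst_comp; apply: subst_ext => x; rewrite /rho; case: eqP => //= _.
  by rewrite /tshift tsubst_comp tsubst_id.
have -> : subst (mix k) p = subst0 (s k) (subst rho p).
  by rewrite E; apply: subst_ext => x; case: eqP => // ->; rewrite /mix ltnn.
have -> : subst (mix k.+1) p = subst0 (r k) (subst rho p).
  rewrite E; apply: subst_ext => x; rewrite /mix ltnS leq_eqVlt.
  by case: eqP => [->|].
move=> h; apply: henkin_closed; apply: (proves_leibniz (t := s k)); exact: proves_ax.
Qed.

Lemma henkin_refl t : D (Eq t t).
Proof. by apply: henkin_closed; exists [::] => //; apply: d_refl. Qed.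

Lemma henkin_sym t u : D (Eq t u) -> D (Eq u t).
Proof.
move=> h; pose s v x := if x is 0 then v else t.
apply: (@henkin_leibniz (Eq (Var 0) (Var 1)) (s t) (s u)); last exact: henkin_refl.
by case=> //= _; apply: henkin_refl.
Qed.

Lemma henkin_trans t u v : D (Eq t u) -> D (Eq u v) -> D (Eq t v).
Proof.
move=> h h'; pose s w x := if x is 0 then w else t.
apply: (@henkin_leibniz (Eq (Var 1) (Var 0)) (s u) (s v)) => //.
by case=> //= _; apply: henkin_refl.
Qed.

Lemma henkin_App f (ts us : {ffun 'I_(far f) -> term S}) :
  (forall i, D (Eq (ts i) (us i))) -> D (Eq (App ts) (App us)).
Proof.
(* Variables below the arity stand for the arguments that vary, the next block for the fixed [ts];
   thus one equation has both the trivial instance and the desired one. *)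
move=> h; pose s (vs : {ffun 'I_(far f) -> term S}) x :=
  if insub x is Some i then vs i else if insub (x - far f) is Some i then ts i else Var 0.
have sE vs : subst (s vs) (Eq (App [ffun i : 'I_(far f) => Var (far f + i)])
    (App [ffun i : 'I_(far f) => Var i])) = Eq (App ts) (App vs).
  congr Eq; congr App; apply/ffunP=> i; rewrite !ffunE /= /s.
    by rewrite insubF ?ltnNge ?leq_addr // addKn valK.
  by rewrite valK.
rewrite -sE; apply: (@henkin_leibniz _ (s ts)); last by rewrite sE; apply: henkin_refl.
by move=> x; rewrite /s; case: insubP => [i _ _|_] //; apply: henkin_refl.
Qed.

Lemma henkin_Rel R (ts us : {ffun 'I_(rar R) -> term S}) :
  (forall i, D (Eq (ts i) (us i))) -> D (Rel ts) -> D (Rel us).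
Proof.
move=> h; pose s (vs : {ffun 'I_(rar R) -> term S}) x :=
  if insub x is Some i then vs i else Var 0.
have sE vs : subst (s vs) (Rel [ffun i : 'I_(rar R) => Var i]) = Rel vs.
  by congr Rel; apply/ffunP=> i; rewrite !ffunE /= /s valK.
rewrite -(sE ts) -(sE us); apply: henkin_leibniz => x.
by rewrite /s; case: insubP => [i _ _|_] //; apply: henkin_refl.
Qed.

Lemma term_model : exists (M : structure S) (e : nat -> M),
  normal M /\ forall p, D p -> sat e p.
Proof.
have [Y [pi [rep [piK piE]]]] := quotient_exists henkin_refl henkin_sym henkin_trans.
pose args n (ys : seq Y) := [ffun i : 'I_n => rep (nth (pi (Var 0)) ys i)].
pose M := @Structure S Y (fun f ys => pi (App (args (far f) ys)))
  (fun R ys => D (Rel (args (rar R) ys))) (fun x y => x = y).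
have argsP n (ts : {ffun 'I_n -> term S}) i :
    D (Eq (args n [seq pi (ts j) | j <- enum 'I_n] i) (ts i)).
  rewrite ffunE (nth_map i) ?size_enum_ord // nth_ord_enum.
  by apply/piE; rewrite piK.
have ev s t : @teval S M (fun x => pi (s x)) t = pi (tsubst s t).
  elim/term_ffun_ind: t => [x|f ts IH] //=.
  have -> : [seq @teval S M (fun x => pi (s x)) (ts i) | i <- enum 'I_(far f)] =
      [seq pi ([ffun i => tsubst s (ts i)] i) | i <- enum 'I_(far f)].
    by apply: eq_map => i; rewrite IH ffunE.
  by apply/piE; apply: henkin_App => i; apply: argsP.
have truth p s : @sat S M (fun x => pi (s x)) p <-> D (subst s p).
  elim: p s => [|t u|R ts|p IHp q IHq|p IH] s /=.
  - by split=> // h; apply: conD; apply: proves_ax.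
  - by rewrite !ev; apply: piE.
  - have -> : [seq @teval S M (fun x => pi (s x)) (ts i) | i <- enum 'I_(rar R)] =
        [seq pi ([ffun i => tsubst s (ts i)] i) | i <- enum 'I_(rar R)].
      by apply: eq_map => i; rewrite ev ffunE.
    split; apply: henkin_Rel => i; first exact: argsP.
    exact/henkin_sym/argsP.
  - by rewrite henkin_Imp IHp IHq.
  - have E t : sat (scons (pi t) (fun x => pi (s x)) : nat -> M) p <->
        D (subst0 t (subst (up s) p)).
      rewrite subst0E -IH; apply: sat_ext => -[] //.
    rewrite henkin_All; split=> h t; first exact/E.
    by rewrite -[t]piK; apply/E.
exists M, (fun x => pi (Var x)); split=> [//|p Dp].
by apply/truth; rewrite subst_id.
Qed.

End Henkin.

(** Satisfaction is claimed under one assignment only, since the theory may contain open formulas,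
    as happens when [completeness] adjoins the negation of an open [p]. *)
Theorem model_existence (S : signature) (T : theory S) :
  bounded T -> consistent T ->
  exists (M : structure S) (e : nat -> M), normal M /\ forall p, T p -> sat e p.
Proof.
move=> bT cT; have [D [conD sub decD]] := henkin_extension bT cT.
have [M [e [nM h]]] := term_model conD decD.
by exists M, e; split=> // p /sub/h.
Qed.

Lemma bounded_is_theory (S : signature) (T : theory S) : is_theory T -> bounded T.
Proof. by move=> hT; exists 0. Qed.

Lemma models_sentences (S : signature) (T : theory S) (M : structure S) (e : nat -> M) :
  is_theory T -> (forall p, T p -> sat e p) -> models M T.
Proof.
move=> hT h p Tp e'; apply: (iffLR (sat_ext_below (hT p Tp) _)) (h p Tp).
by [].
Qed.

Theorem completeness (S : signature) (T : theory S) p :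
  is_theory T ->
  (forall M : structure S, normal M -> models M T -> forall e : nat -> M, sat e p) ->
  proves T p.
Proof.
move=> hT h; apply: proves_raa; apply: NNPP => con.
have [M [e [nM MT]]] := model_existence (bounded_extend _ (bounded_is_theory hT)) con.
apply: (MT (Not p)); first by right.
by apply: h => //; apply: (models_sentences (e := e)) => // q Tq; apply: MT; left.
Qed.

(** * Translations *)

Section Below.
Variable S : signature.
Implicit Types (p q : form S).

Lemma below_Alls n k p : below n (Alls k p) = below (k + n) p.
Proof. by elim: k n => //= k IH n; rewrite IH addSnnS. Qed.

Lemma below_Imp n p q : below n (Imp p q) = below n p && below n q.
Proof. by []. Qed.

Lemma below_And n p q : below n (And p q) = below n p && below n q.
Proof. by rewrite /= !andbT. Qed.

Lemma below_Ex n p : below n (Ex p) = below n.+1 p.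
Proof. by rewrite /= !andbT. Qed.

Lemma below_Exs n k p : below n (Exs k p) = below (k + n) p.
Proof. by elim: k n => // k IH n; rewrite [Exs _ _]/(Ex (Exs k p)) below_Ex IH addSnnS. Qed.

Lemma below_bigAnd n (ps : seq (form S)) : below n (bigAnd ps) = all (below n) ps.
Proof. by elim: ps => // p ps IH; rewrite [bigAnd _]/(And p (bigAnd ps)) below_And IH. Qed.

Lemma below_inst m p (xs : seq nat) :
  below (size xs) p -> all (ltn^~ m) xs -> below m (inst p xs).
Proof. by move=> hp /(all_nthP 0) h; apply: below_subst hp _ => x /h. Qed.

Lemma below_relv n (R : rl S) (xs : seq nat) :
  size xs = rar R -> below n (relv R xs) = all (ltn^~ n) xs.
Proof.
move=> sz; apply/forallP/(all_nthP 0) => h i.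
  by rewrite sz => lt; have := h (Ordinal lt); rewrite ffunE.
by rewrite ffunE; apply: h; rewrite sz.
Qed.

End Below.

Lemma below_unravel (S : signature) n (p : form S) : below n p -> below n (unravel p).
Proof.
have bval k s m y (t : term S) :
    tbelow k t -> (forall x, x < k -> s x < m) -> y < m -> below m (value s y t).
  elim/term_ffun_ind: t s m y => [x|f ts IH] s m y /=.
    by move=> xk /(_ _ xk) -> ->.
  move/forallP=> h hs ym; rewrite below_Exs below_And below_bigAnd below_relv; last first.
    by rewrite size_rcons size_iota.
  apply/andP; split.
    rewrite all_map; apply/allP=> i _ /=; apply: IH => //; last exact: leq_trans (leq_addr _ _).
    by move=> x /hs; rewrite ltn_add2l.
  rewrite all_rcons /= ltn_add2l ym; apply/allP=> x; rewrite mem_iota add0n => /= h'.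
  exact: leq_trans (leq_addr _ _).
elim: p n => [|t u|R ts|p IHp q IHq|p IH] n //=.
- move=> /andP[ht hu]; rewrite !andbT.
  by apply/andP; split; apply: (bval n).
- move/forallP=> h; rewrite below_Exs below_And below_bigAnd below_relv ?size_iota //.
  apply/andP; split.
    rewrite all_map; apply/allP=> i _ /=; apply: (bval n) => //.
      by move=> x; rewrite ltn_add2l.
    exact: leq_trans (leq_addr _ _).
  by apply/allP=> x; rewrite mem_iota add0n => /= h'; apply: leq_trans (leq_addr _ _).
- by move=> /andP[/IHp -> /IHq ->].
- exact: IH.
Qed.

Lemma sentence_identity_axioms (S : signature) : sentence (identity_axioms S).
Proof.
rewrite /sentence /identity_axioms below_bigAnd !all_cat !all_map; apply/and4P; split=> //.
- apply/allP=> R _; change (below 0 (congruence R)); rewrite below_Alls addn0.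
  rewrite !below_Imp below_bigAnd !below_relv ?size_iota //; apply/and3P; split.
  + rewrite all_map; apply/allP=> i; rewrite mem_iota add0n => /= h.
    by rewrite ltn_add2l h (leq_trans h) // leq_addr.
  + apply/allP=> x; rewrite mem_iota add0n => /= h.
    by rewrite (leq_trans h) // leq_addr.
  + by apply/allP=> x; rewrite mem_iota => /andP[].
- apply/allP=> f _; change (below 0 (total f)); rewrite below_Alls addn0.
  rewrite below_Ex below_relv ?size_rcons ?size_iota // all_rcons /=.
  by apply/allP=> x; rewrite mem_iota => /andP[].
- apply/allP=> f _; change (below 0 (functional f)); rewrite below_Alls addn0.
  rewrite !below_Imp !below_relv ?size_rcons ?size_iota // !all_rcons /= ?andbT ?andbb.
  by apply/allP=> x; rewrite mem_iota => /andP[].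
Qed.

Lemma In_mem (A : eqType) (x : A) s : List.In x s <-> x \in s.
Proof.
elim: s => //= y s IH; rewrite in_cons; split.
  by move=> [->|/IH ->]; rewrite ?eqxx ?orbT.
by case/orP=> [/eqP|/IH]; auto.
Qed.

Lemma sat_bigAnd_cat (S : signature) (M : structure S) (e : nat -> M) (s1 s2 : seq (form S)) :
  sat e (bigAnd (s1 ++ s2)) <-> sat e (bigAnd s1) /\ sat e (bigAnd s2).
Proof.
rewrite !sat_bigAnd; split=> [h|[h1 h2] p /List.in_app_iff[/h1|/h2]] //.
by split=> p hp; apply/h/List.in_app_iff; [left|right].
Qed.

Lemma sat_bigAnd_map (S : signature) (M : structure S) (e : nat -> M) (I : eqType)
    (F : I -> form S) (s : seq I) :
  sat e (bigAnd [seq F i | i <- s]) <-> forall i, i \in s -> sat e (F i).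
Proof.
rewrite sat_bigAnd; split=> [h i si|h p /List.in_map_iff[i [<- /In_mem]]]; last exact: h.
by apply/h/List.in_map/In_mem.
Qed.

Lemma sat_relv (S : signature) (M : structure S) (e : nat -> M) (R : rl S) (xs : seq nat) :
  size xs = rar R -> sat e (relv R xs) <-> rlI R (map e xs).
Proof.
move=> sz; rewrite /=; set l := (X in rlI R X).
suff -> : l = map e xs by [].
have szl : size l = rar R by rewrite size_map size_enum_ord.
apply: (@eq_from_nth _ (e 0)); rewrite szl ?size_map // => i lt.
rewrite (nth_map 0) ?sz // (nth_map (Ordinal lt)) ?size_enum_ord // ffunE /=.
by rewrite nth_enum_ord.
Qed.

Section EnvCat.
Variables (S : signature) (M : structure S).
Implicit Types (xs ys : seq M) (e : nat -> M).

Lemma env_cat_lt xs e d i : i < size xs -> env_cat xs e i = nth d xs i.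
Proof. exact: set_nth_default. Qed.

Lemma env_cat_ge xs e n i : size xs = n -> env_cat xs e (n + i) = e i.
Proof. by move=> <-; rewrite /env_cat nth_default ?leq_addr // addKn. Qed.

Lemma map_env_cat_iota xs e a n :
  a + n <= size xs -> map (env_cat xs e) (iota a n) = take n (drop a xs).
Proof.
move=> le; have sz : size (take n (drop a xs)) = n.
  by rewrite size_takel // size_drop leq_subRL // (leq_trans (leq_addr _ _) le).
apply: (@eq_from_nth _ (e 0)); rewrite size_map size_iota // => i lt.
rewrite (nth_map 0) ?size_iota // nth_iota // nth_take // nth_drop.
by apply: env_cat_lt; apply: leq_trans le; rewrite ltn_add2l.
Qed.

Lemma map_env_cat xs e n : size xs = n -> map (env_cat xs e) (iota 0 n) = xs.
Proof. by move=> <-; rewrite map_env_cat_iota ?drop0 ?take_size. Qed.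

End EnvCat.

Local Arguments rar : simpl never.

Lemma sat_Imp (S : signature) (M : structure S) (e : nat -> M) (p q : form S) :
  sat e (Imp p q) <-> (sat e p -> sat e q).
Proof. by []. Qed.

(** * The structure defined by a translation *)

Section TranslatedStructure.
Variables (S T : signature) (tau : translation S T) (N : structure T) (d0 : N).
Local Notation G := (graph_sig S).

Definition objects :=
  {o : piece tau * seq N | size o.2 = dim o.1 /\ sat (nth d0 o.2) (dom o.1)}.

Definition translated : structure G := @Structure G objects
  (fun f => match f with end)
  (fun R os => sat (nth d0 (flatten [seq (sval o).2 | o <- os]))
    (relt [ffun j : 'I_(rar R) => nth (piece0 tau) [seq (sval o).1 | o <- os] j]))
  (fun x y => sat (nth d0 ((sval x).2 ++ (sval y).2)) (eqt (sval x).1 (sval y).1)).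

Definition represents (e : nat -> N) (r : nat -> object tau) (rho : nat -> translated) x :=
  (sval (rho x)).1 = (r x).1 /\ (sval (rho x)).2 = map e (r x).2.

Lemma sat_inst_nth (e : nat -> N) (xs : seq nat) p :
  below (size xs) p -> sat e (inst p xs) <-> sat (nth d0 (map e xs)) p.
Proof.
move=> hp; rewrite sat_inst; apply: sat_ext_below hp _ => x lt.
by rewrite (nth_map 0).
Qed.

Lemma represents_size e r rho x : represents e r rho x -> size (r x).2 = dim (r x).1.
Proof. by move=> [<- h]; rewrite -(size_map e) -h; case: (svalP (rho x)). Qed.

(** No identity axioms are assumed: [eqI] on [translated] is whatever relation the formulas [eqt]
    define, so the equivalence holds for every translation. A quantifier over objects becomes one
    over blocks of variables, and pushing a block onto the environment corresponds to [scons]. *)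
Lemma sat_translate n (p : form G) e r rho :
  below n p -> (forall x, x < n -> represents e r rho x) ->
  sat e (translate_open r p) <-> sat rho p.
Proof.
elim: p n e r rho => [|[x|[]] [y|[]]|R ts|p IHp q IHq|p IH] n e r rho //=.
- move=> /andP[/[swap] yn xn] h; have [hx1 hx2] := h _ xn; have [hy1 hy2] := h _ yn.
  rewrite sat_inst_nth; first by rewrite hx1 hx2 hy1 hy2 map_cat.
  rewrite size_cat (represents_size (h _ xn)) (represents_size (h _ yn)).
  exact: eqt_below.
- move/forallP=> hts h.
  have ht i : exists2 x, ts i = Var x & represents e r rho x.
    by move: (hts i); case: (ts i) => [x /h|[]]; exists x.
  have -> : [ffun j => (lookup r (ts j)).1] = [ffun j : 'I_(rar R) =>
     nth (piece0 tau) [seq (sval o).1 | o <- [seq teval rho (ts i) | i <- enum 'I_(rar R)]] j].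
    apply/ffunP=> j; rewrite !ffunE -map_comp (nth_map j) ?size_enum_ord // nth_ord_enum /=.
    by have [x -> [-> _]] := ht j.
  rewrite sat_inst_nth.
    suff -> : map e (flatten [seq (lookup r (ts j)).2 | j <- enum 'I_(rar R)]) =
      flatten [seq (sval o).2 | o <- [seq teval rho (ts i) | i <- enum 'I_(rar R)]] by [].
    rewrite map_flatten; congr flatten; rewrite -map_comp -[RHS]map_comp.
    by apply: eq_map => i /=; have [x -> [_ ->]] := ht i.
  rewrite size_flatten /shape -map_comp sumnE big_map big_enum /=.
  apply: below_leq (relt_below _); apply: eq_leq; apply: eq_bigr => i _; rewrite ffunE.
  rewrite -map_comp (nth_map i) ?size_enum_ord // nth_ord_enum /=.
  by have [x -> hx] := ht i; rewrite /= (represents_size hx); case: hx => ->.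
- by move=> /andP[hp hq] h; rewrite (IHp n e r rho) // (IHq n e r rho).
move=> hp h; rewrite sat_bigAnd_map.
have step (o : objects) : sat (env_cat (sval o).2 e) (translate_open (push (sval o).1 r) p) <->
    sat (scons (o : translated) rho) p.
  case: (svalP o) => sz _; apply: (IH n.+1) => // -[_|x xn]; split=> //=.
  - by rewrite map_env_cat.
  - by case: (h _ xn).
  - case: (h _ xn) => _ ->; rewrite -map_comp; apply: eq_map => k /=.
    by rewrite /env_cat -sz nth_default ?leq_addr // addKn.
have domE (i : piece tau) xs : size xs = dim i ->
    sat (env_cat xs e) (dom i) <-> sat (nth d0 xs) (dom i).
  move=> sz; apply: sat_ext_below (dom_below i) _ => x lt.
  by apply: set_nth_default; rewrite sz.
split=> [H o|H i _].
  apply/step; case: (svalP o) => sz hd; have := H (sval o).1 (mem_enum _ _).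
  by move/sat_Alls => /(_ _ sz); apply; apply/domE.
apply/sat_Alls => xs sz /= /(domE _ _ sz) hd.
by have := H (exist _ (i, xs) (conj sz hd)); move/step.
Qed.

(** Without objects every conjunct of a translated universal formula holds vacuously. The point is
    needed because satisfaction in [translated] speaks of assignments into it. *)
Lemma translate_Ex_inhabited (e : nat -> N) (r : nat -> object tau) (p : form G) :
  sat e (translate_open r (Ex p)) -> inhabited objects.
Proof.
move=> h; apply: NNPP => no; apply: h; apply/sat_bigAnd_map => i _.
apply/sat_Alls => xs sz /= hd; case: no; constructor.
exists (i, xs); split=> //=; apply: (iffLR (sat_ext_below (dom_below i) _)) hd => x lt.
by apply: set_nth_default; rewrite sz.
Qed.

End TranslatedStructure.

Lemma below_translate (S T : signature) (tau : translation S T) n m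
    (r : nat -> object tau) (p : form (graph_sig S)) :
  below n p ->
  (forall x, x < n -> size (r x).2 = dim (r x).1 /\ all (ltn^~ m) (r x).2) ->
  below m (translate_open r p).
Proof.
elim: p n m r => [|[x|[]] [y|[]]|R ts|p IHp q IHq|p IH] n m r //=.
- move=> /andP[xn yn] h; have [hx1 hx2] := h _ xn; have [hy1 hy2] := h _ yn.
  apply: below_inst; last by rewrite all_cat hx2.
  by rewrite size_cat hx1 hy1; apply: eqt_below.
- move/forallP=> hts h.
  have ht i : size (lookup r (ts i)).2 = dim (lookup r (ts i)).1 /\
      all (ltn^~ m) (lookup r (ts i)).2.
    by move: (hts i); case: (ts i) => [x /h|[]].
  apply: below_inst.
    rewrite size_flatten /shape -map_comp sumnE big_map big_enum /=.
    apply: below_leq (relt_below _); apply: eq_leq; apply: eq_bigr => i _; rewrite ffunE.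
    by case: (ht i).
  by apply/allP=> k /flattenP[s /mapP[i _ ->]]; have [_ /allP] := ht i; apply.
- by move=> /andP[hp hq] h; rewrite (IHp n) ?(IHq n).
move=> hp h; rewrite below_bigAnd all_map; apply/allP=> i _ /=; rewrite below_Alls /=.
rewrite (below_leq _ (dom_below i)) ?leq_addr //=; apply: (IH n.+1) => // -[_|x xn] /=.
  rewrite size_iota; split=> //; apply/allP=> k; rewrite mem_iota add0n => /= lt.
  exact: leq_trans (leq_addr _ _).
have [h1 h2] := h _ xn; rewrite size_map; split=> //.
by rewrite all_map; apply: sub_all h2 => k /=; rewrite ltn_add2l.
Qed.

Lemma sentence_translate (S T : signature) (tau : translation S T) (p : form (graph_sig S)) :
  sentence p -> sentence (translate tau p).
Proof. by move=> hp; apply: (below_translate hp). Qed.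

(** * Graphs of functions *)

Record identity_facts (S : signature) (G : structure (graph_sig S)) (d : G) : Prop := {
  id_refl : forall x : G, eqI x x;
  id_sym : forall x y : G, eqI x y -> eqI y x;
  id_trans : forall x y z : G, eqI x y -> eqI y z -> eqI x z;
  id_congr : forall R (xs ys : seq G), size xs = rar R -> size ys = rar R ->
    (forall i, i < rar R -> eqI (nth d xs i) (nth d ys i)) -> rlI R xs -> rlI R ys;
  id_total : forall (f : fn S) (xs : seq G), size xs = far f ->
    exists y, rlI (inl f : rl (graph_sig S)) (rcons xs y);
  id_functional : forall (f : fn S) (xs : seq G) y z, size xs = far f ->
    rlI (inl f : rl (graph_sig S)) (rcons xs y) ->
    rlI (inl f : rl (graph_sig S)) (rcons xs z) -> eqI y z
}.

Section IdentityFacts.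
Variables (S : signature) (G : structure (graph_sig S)).
Implicit Types (e : nat -> G) (xs ys : seq G).
Local Notation graph f := (inl f : rl (graph_sig S)).

Lemma sat_congruence e (R : rl (graph_sig S)) :
  sat e (congruence R) <-> forall xs ys, size xs = rar R -> size ys = rar R ->
    (forall i, i < rar R -> eqI (nth (e 0) xs i) (nth (e 0) ys i)) -> rlI R xs -> rlI R ys.
Proof.
rewrite sat_Alls.
have E xs ys : size xs = rar R -> size ys = rar R ->
    sat (env_cat (xs ++ ys) e) (Imp
      (bigAnd [seq eqv S i (rar R + i) | i <- iota 0 (rar R)])
      (Imp (relv R (iota 0 (rar R))) (relv R (iota (rar R) (rar R))))) <->
    ((forall i, i < rar R -> eqI (nth (e 0) xs i) (nth (e 0) ys i)) -> rlI R xs -> rlI R ys).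
  move=> sx sy; have sxy : size (xs ++ ys) = rar R + rar R by rewrite size_cat sx sy.
  rewrite sat_Imp sat_bigAnd_map sat_Imp !sat_relv ?size_iota //.
  rewrite !map_env_cat_iota ?sxy ?leq_addr // drop0 take_size_cat // drop_size_cat //.
  rewrite (@take_oversize _ (rar R) ys) ?sy //.
  have eqE i : i < rar R -> sat (env_cat (xs ++ ys) e) (eqv S i (rar R + i)) <->
      eqI (nth (e 0) xs i) (nth (e 0) ys i).
    move=> lt; rewrite /= !(env_cat_lt _ (e 0)) ?sxy ?ltn_add2l ?(leq_trans lt) ?leq_addr //.
    by rewrite !nth_cat sx lt ltnNge leq_addr /= addKn.
  split=> h hi; apply: h => i lt.
    by rewrite mem_iota add0n in lt; apply/eqE => //; apply: hi.
  by apply/eqE => //; apply: hi; rewrite mem_iota add0n.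
split=> h.
  by move=> xs ys sx sy; apply/E => //; apply: h; rewrite size_cat sx sy.
move=> zs sz; rewrite -[zs](cat_take_drop (rar R)).
have s1 : size (take (rar R) zs) = rar R by rewrite size_takel // sz leq_addr.
have s2 : size (drop (rar R) zs) = rar R by rewrite size_drop sz addKn.
by apply/E => //; apply: h.
Qed.

Lemma sat_total e (f : fn S) :
  sat e (total f) <-> forall xs, size xs = far f -> exists y, rlI (graph f) (rcons xs y).
Proof.
rewrite sat_Alls.
have E xs : size xs = far f -> sat (env_cat xs e) (Ex (relv (graph f) (rcons (iota 1 (far f)) 0)))
    <-> exists y, rlI (graph f) (rcons xs y).
  move=> sx; rewrite sat_Ex.
  have E y : sat (scons y (env_cat xs e)) (relv (graph f) (rcons (iota 1 (far f)) 0)) <->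
      rlI (graph f) (rcons xs y).
    rewrite sat_relv ?size_rcons ?size_iota // map_rcons /=.
    by rewrite -add1n iotaDl -map_comp (@eq_map _ _ _ (env_cat xs e)) // map_env_cat.
  by split=> -[y hy]; exists y; apply/E.
by split=> h xs sx; apply/E => //; apply: h.
Qed.

Lemma sat_functional e (f : fn S) :
  sat e (functional f) <-> forall xs y z, size xs = far f ->
    rlI (graph f) (rcons xs y) -> rlI (graph f) (rcons xs z) -> eqI y z.
Proof.
rewrite sat_Alls.
have E xs y z : size xs = far f ->
    sat (env_cat [:: y, z & xs] e) (Imp (relv (graph f) (rcons (iota 2 (far f)) 0))
      (Imp (relv (graph f) (rcons (iota 2 (far f)) 1)) (eqv S 0 1))) <->
    (rlI (graph f) (rcons xs y) -> rlI (graph f) (rcons xs z) -> eqI y z).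
  move=> sx; rewrite !sat_Imp !sat_relv ?size_rcons ?size_iota // !map_rcons /=.
  by rewrite map_env_cat_iota /= ?sx ?add2n // drop0 -sx take_size.
split=> h.
  by move=> xs y z sx; apply/E => //; apply: h; rewrite /= sx.
by case=> [|y [|z xs]] // [sx]; apply/E => //; apply: h.
Qed.

Lemma sat_identity_axioms e : sat e (identity_axioms S) <-> identity_facts (e 0).
Proof.
rewrite /identity_axioms !sat_bigAnd_cat !sat_bigAnd_map; split.
  move=> [h [hc [ht hf]]]; move: h; rewrite sat_bigAnd => h; split.
  - by move=> x; apply: (h (All (eqv S 0 0)) _ x); left.
  - by move=> x y; apply: (h (Alls 2 (Imp (eqv S 0 1) (eqv S 1 0))) _ y x); right; left.
  - move=> x y z.
    apply: (h (Alls 3 (Imp (eqv S 0 1) (Imp (eqv S 1 2) (eqv S 0 2)))) _ z y x).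
    by right; right; left.
  - by move=> R xs ys; apply: (iffLR (sat_congruence e R)); apply: hc; rewrite mem_enum.
  - by move=> f xs; apply: (iffLR (sat_total e f)); apply: ht; rewrite mem_enum.
  - by move=> f xs y z; apply: (iffLR (sat_functional e f)); apply: hf; rewrite mem_enum.
move=> [h1 h2 h3 h4 h5 h6]; split; last split; last split.
- apply/sat_bigAnd => p /= [<-|[<-|[<-|[<-|//]]]].
  + by move=> x; apply: h1.
  + by move=> x y; apply: h2.
  + by move=> x y z; apply: h3.
  + by apply/sat_Ex; exists (e 0); apply: h1.
- by move=> R _; apply/sat_congruence; apply: h4.
- by move=> f _; apply/sat_total; apply: h5.
- by move=> f _; apply/sat_functional; apply: h6.
Qed.

End IdentityFacts.

(** [G] is the relational form of [M] up to the identity of [G]: [pi] is a quotient map and [rep] a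
    section of it. The case of [graph_structure] has both equal to [id]; for a structure defined by
    a translation the quotient is a proper step. *)
Record graph_of (S : signature) (G : structure (graph_sig S)) (M : structure S)
    (pi : G -> M) (rep : M -> G) : Prop := {
  graph_cancel : forall y, pi (rep y) = y;
  graph_eq : forall x y : G, eqI x y <-> pi x = pi y;
  graph_rl : forall (R : rl S) (xs : seq G), size xs = rar R ->
    rlI (inr R : rl (graph_sig S)) xs <-> rlI R (map pi xs);
  graph_fn : forall (f : fn S) (xs : seq G) y, size xs = far f ->
    rlI (inl f : rl (graph_sig S)) (rcons xs y) <-> fnI f (map pi xs) = pi y
}.

Section GraphOf.
Variables (S : signature) (G : structure (graph_sig S)) (M : structure S).
Variables (pi : G -> M) (rep : M -> G).
Hypotheses (nM : normal M) (GM : graph_of pi rep).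
Implicit Types (e : nat -> G) (t : term S) (p : form S).

Let value_spec t := forall e (s : nat -> nat) y,
  sat e (value s y t) <-> teval (fun x => pi (e (s x))) t = pi (e y).

Lemma sat_values n (ts : {ffun 'I_n -> term S}) e s (xs : seq G) :
  (forall i, value_spec (ts i)) -> size xs = n ->
  sat (env_cat xs e)
    (bigAnd [seq value (fun x => n + s x) (val i) (ts i) | i <- enum 'I_n]) <->
  [seq teval (fun x => pi (e (s x))) (ts i) | i <- enum 'I_n] = map pi xs.
Proof.
move=> IH sx; rewrite sat_bigAnd_map.
have V (i : 'I_n) : sat (env_cat xs e) (value (fun x => n + s x) (val i) (ts i)) <->
    teval (fun x => pi (e (s x))) (ts i) = pi (nth (e 0) xs i).
  rewrite IH (env_cat_lt _ (e 0)); last by rewrite sx; apply: ltn_ord.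
  by rewrite (@teval_ext _ _ _ (fun x => pi (e (s x)))) // => x; rewrite (env_cat_ge _ _ sx).
split=> h.
  apply: (@eq_from_nth _ (pi (e 0))); first by rewrite size_map size_enum_ord size_map.
  move=> k; rewrite size_map size_enum_ord => lt.
  rewrite (nth_map (Ordinal lt)) ?size_enum_ord // (nth_map (e 0)) ?sx //.
  rewrite (nth_ord_enum (Ordinal lt) (Ordinal lt)).
  by apply/(V (Ordinal lt)); apply: h; rewrite mem_enum.
move=> i _; apply/V; have := f_equal (fun l => nth (pi (e 0)) l i) h.
by rewrite (nth_map i) ?size_enum_ord // nth_ord_enum (nth_map (e 0)) ?sx.
Qed.

Lemma exists_values n (ts : {ffun 'I_n -> term S}) (e : nat -> M) :
  exists2 xs, size xs = n & [seq teval e (ts i) | i <- enum 'I_n] = map pi xs.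
Proof.
exists (map rep [seq teval e (ts i) | i <- enum 'I_n]).
  by rewrite size_map size_map size_enum_ord.
by rewrite -[RHS]map_comp (@eq_map _ _ _ id) ?map_id // => z; apply: (graph_cancel GM).
Qed.

Lemma sat_value t : value_spec t.
Proof.
elim/term_ffun_ind: t => [x|f ts IH] e s y /=; first exact: (graph_eq GM).
have E xs : size xs = far f ->
    sat (env_cat xs e) (relv (inl f : rl (graph_sig S)) (rcons (iota 0 (far f)) (far f + y))) <->
    fnI f (map pi xs) = pi (e y).
  move=> sx; rewrite sat_relv ?size_rcons ?size_iota //.
  by rewrite map_rcons (env_cat_ge _ _ sx) (map_env_cat _ sx) (graph_fn GM).
rewrite sat_Exs; split=> [[xs sx]|].
  by rewrite sat_And sat_values // E // => -[-> ->].
have [xs sx Exs] := exists_values ts (fun x => pi (e (s x))); rewrite Exs => h.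
by exists xs => //; rewrite sat_And sat_values // E.
Qed.

Lemma sat_unravel e p : sat e (unravel p) <-> sat (fun x => pi (e x)) p.
Proof.
elim: p e => [|t u|R ts|p IHp q IHq|p IH] e.
- by [].
- rewrite sat_Ex.
  have E y : sat (scons y e) (And (value succn 0 t) (value succn 0 u)) <->
      teval (fun x => pi (e x)) t = pi y /\ teval (fun x => pi (e x)) u = pi y.
    by rewrite sat_And !sat_value.
  rewrite /= nM; split=> [[y /E[-> ->]] //|h].
  exists (rep (teval (fun x => pi (e x)) t)); apply/E.
  by rewrite -h (graph_cancel GM).
- rewrite /= sat_Exs.
  have E xs : size xs = rar R ->
      sat (env_cat xs e) (relv (inr R : rl (graph_sig S)) (iota 0 (rar R))) <->
      rlI R (map pi xs).
    by move=> sx; rewrite sat_relv ?size_iota // (map_env_cat _ sx) (graph_rl GM).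
  have V i : value_spec (ts i) by apply: sat_value.
  split=> [[xs sx]|].
    by rewrite sat_And (sat_values e id) // E // => -[->].
  have [xs sx Exs] := exists_values ts (fun x => pi (e x)); rewrite Exs => h.
  by exists xs => //; rewrite sat_And (sat_values e id) // E.
- by rewrite /= IHp IHq.
- have E x : sat (scons x e) (unravel p) <-> sat (scons (pi x) (fun x => pi (e x))) p.
    by rewrite IH; apply: sat_ext => -[].
  split=> /= h x; last by apply/E/h.
  by rewrite -[x](graph_cancel GM); apply/E/h.
Qed.

Lemma graph_of_identity_facts (d : G) : identity_facts d.
Proof.
split.
- by move=> x; apply/(graph_eq GM).
- by move=> x y /(graph_eq GM) h; apply/(graph_eq GM).
- by move=> x y z /(graph_eq GM) h /(graph_eq GM) h'; apply/(graph_eq GM); rewrite h.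
- move=> R xs ys sx sy h.
  have E i : i < rar R -> pi (nth d xs i) = pi (nth d ys i) by move=> /h/(graph_eq GM).
  case: R sx sy E {h} => [f|R] sx sy E.
    case/lastP: xs sx E => [|xs x] //; case/lastP: ys sy => [|ys y] //.
    rewrite !size_rcons => -[sy] [sx] E.
    rewrite !(graph_fn GM) //.
    have -> : pi x = pi y.
      by move: (E _ (ltnSn (far f))); rewrite !nth_rcons sx sy ltnn eqxx.
    suff -> : map pi xs = map pi ys by [].
    apply: (@eq_from_nth _ (pi d)); rewrite !size_map sx // => i lt.
    rewrite !(nth_map d) ?sx ?sy //.
    by move: (E i (ltnW lt)); rewrite !nth_rcons sx sy lt.
  rewrite !(graph_rl GM) //.
  suff -> : map pi xs = map pi ys by [].
  apply: (@eq_from_nth _ (pi d)); rewrite !size_map sx // => i lt.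
  by rewrite !(nth_map d) ?sx ?sy // E.
- move=> f xs sx; exists (rep (fnI f (map pi xs))).
  by apply/(graph_fn GM) => //; rewrite (graph_cancel GM).
- by move=> f xs y z sx; rewrite !(graph_fn GM) // (graph_eq GM) => -> ->.
Qed.

End GraphOf.

(** [M] is the quotient by the interpreted identity. Totality lets [epsilon] choose the value of a
    function; functionality and congruence make the class of that value independent of the choice
    and of the representatives. *)
Lemma graph_of_exists (S : signature) (G : structure (graph_sig S)) (d : G) :
  identity_facts d ->
  exists (M : structure S) (pi : G -> M) (rep : M -> G), normal M /\ graph_of pi rep.
Proof.
move=> [h1 h2 h3 h4 h5 h6].
have [Y [pi [rep [piK piE]]]] := quotient_exists h1 h2 h3.
pose fn (f : fn S) (ys : seq Y) := pi (epsilon (inhabits d)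
  (fun y => rlI (inl f : rl (graph_sig S)) (rcons (map rep ys) y))).
pose M := @Structure S Y fn (fun R ys => rlI (inr R : rl (graph_sig S)) (map rep ys)) eq.
exists M, pi, rep; split=> //.
have close (xs : seq G) i : eqI (nth d (map rep (map pi xs)) i) (nth d xs i).
  case: (ltnP i (size xs)) => lt; last by rewrite !nth_default ?size_map.
  rewrite -map_comp (nth_map d) // -piE piK //.
have sz (xs : seq G) : size (map rep (map pi xs)) = size xs by rewrite !size_map.
split=> //.
- by move=> x y; rewrite piE.
- move=> R xs sx; split.
    by apply: h4; rewrite ?sz // => i _; apply/h2/close.
  by apply: h4; rewrite ?sz // => i _; apply: close.
move=> f xs y sx; rewrite /= /fn.
set zs := map rep (map pi xs); set P := (fun y => _).
have szs : size zs = far f by rewrite sz.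
have hP : P (epsilon (inhabits d) P) by apply: epsilon_spec; apply: h5.
have step z : rlI (inl f : rl (graph_sig S)) (rcons xs z) <-> P z.
  have cl i : eqI (nth d (rcons zs z) i) (nth d (rcons xs z) i).
    rewrite !nth_rcons szs sx; case: ifP => _; first exact: close.
    by case: ifP.
  by split; apply: h4; rewrite ?size_rcons ?szs ?sx // => i _; apply/h2.
rewrite step piE; split=> h; first exact: h6 hP h.
apply: h4 hP; rewrite ?size_rcons ?szs // => i _.
by rewrite !nth_rcons szs; case: ifP => // _; case: ifP.
Qed.

Definition graph_structure (S : signature) (M : structure S) : structure (graph_sig S) :=
  @Structure (graph_sig S) M (fun f => match f with end)
    (fun R xs => match R with
       | inl f => exists ys y, [/\ size ys = far f, xs = rcons ys y & fnI f ys = y]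
       | inr R => rlI R xs end) eq.

Lemma graph_of_graph_structure (S : signature) (M : structure S) :
  graph_of (G := graph_structure M) (M := M) id id.
Proof.
split=> // [R xs _|f xs y sx]; rewrite map_id //=.
split=> [[ys [z [_ /rcons_inj[-> ->]]]]//|h].
by exists xs, y.
Qed.

(** * Shortening cuts *)

Section Operations.
Variable M : structure arith.
Definition mzero : M := fnI (Zero : fn arith) [::].
Definition msucc (x : M) : M := fnI (Succ : fn arith) [:: x].
Definition madd (x y : M) : M := fnI (Plus : fn arith) [:: x; y].
Definition mmul (x y : M) : M := fnI (Times : fn arith) [:: x; y].

Definition mle (x y : M) := exists z, madd z x = y.
(** Divisibility by [msucc u]. The moduli to come have the form 1 + (k + 1) b, and with a successor
    as divisor the quotient is at most [y], so that it can be found by a bounded quantifier. *)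
Definition mdvd (u y : M) := exists q, mmul q (msucc u) = y.

(* The pair [(a, b)] codes the set of all [k] such that [1 + (k + 1) b]
   divides [a]. *)
Definition mmem (k a b : M) := mdvd (mmul (msucc k) b) a.

(** Robinson's axioms with the identities of a commutative semiring. The latter are true universal
    equations, hence available among the true [Pi1] sentences. *)
Record arith_facts : Prop := {
  succ_neq0 : forall x, msucc x <> mzero;
  succ_inj : forall x y, msucc x = msucc y -> x = y;
  zero_or_succ : forall x, x = mzero \/ exists y, x = msucc y;
  addx0 : forall x, madd x mzero = x;
  addxS : forall x y, madd x (msucc y) = msucc (madd x y);
  mulx0 : forall x, mmul x mzero = mzero;
  mulxS : forall x y, mmul x (msucc y) = madd (mmul x y) x;
  addC : forall x y, madd x y = madd y x;
  addA : forall x y z, madd x (madd y z) = madd (madd x y) z;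
  mulC : forall x y, mmul x y = mmul y x;
  mulA : forall x y z, mmul x (mmul y z) = mmul (mmul x y) z;
  mulDl : forall x y z, mmul (madd x y) z = madd (mmul x z) (mmul y z)
}.

(** In the standard model the divisibility of [b] by 1, ..., n + 1 makes the moduli 1 + (j + 1) b
    pairwise coprime, as in Gödel's beta function. Their common multiple [m] is then an upper bound
    for codes of all subsets of [0, n]. *)
Definition codes_room (n b m : M) :=
  b <> mzero /\ m <> mzero /\
  forall j, mle j n -> mdvd j b /\ mdvd (mmul (msucc j) b) m.

End Operations.

Arguments mzero {M}.

Section Cuts.
Variables (M : structure arith) (facts : arith_facts M).
Variable good : M -> M -> M -> Prop.

Local Notation "0" := (mzero : M).
Local Notation "x + y" := (madd x y : M).
Local Notation "x * y" := (mmul x y : M).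
Local Notation "x <= y" := (mle x y).
Local Notation S := (@msucc M).
Local Notation "x < y" := (mle (S x) y).

Implicit Types (x y z i j k l m n u a b c : M).

Lemma semi_ring_M : semi_ring_theory 0 (S 0) (@madd M) (@mmul M) eq.
Proof.
case: facts => _ _ _ a0 aS m0 mS aC aA mC mA mD; split=> //.
- by move=> n; rewrite aC a0.
- by move=> n; rewrite mC mS m0 aC a0.
- by move=> n; rewrite mC m0.
Qed.

Add Ring M_ring : semi_ring_M.

Lemma succE x : S x = x + S 0.
Proof. by rewrite (addxS facts) (addx0 facts). Qed.

Lemma mle_refl x : x <= x.
Proof. by exists 0; ring. Qed.

Lemma mle_trans y x z : x <= y -> y <= z -> x <= z.
Proof. by move=> [u <-] [v <-]; exists (v + u); ring. Qed.

Lemma mle_addr x y : x <= x + y.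
Proof. by exists y; ring. Qed.

Lemma mle_addl x y : x <= y + x.
Proof. by exists y. Qed.

Lemma mle0 x : x <= 0 -> x = 0.
Proof.
move=> [z]; have [//|[y ->]] := zero_or_succ facts x.
by rewrite (addxS facts) => /(succ_neq0 facts).
Qed.

Lemma mle_succ_cases x y : x <= S y -> x <= y \/ x = S y.
Proof.
move=> [z]; have [->|[u ->]] := zero_or_succ facts z.
  by right; transitivity (0 + x) => //; ring.
move=> h; left; exists u; apply: (succ_inj facts); rewrite -h.
by rewrite (addC facts (S u)) (addxS facts) (addC facts).
Qed.

Lemma mltS x y : x < S y -> x <= y.
Proof. by move=> [z]; rewrite (addxS facts) => /(succ_inj facts) h; exists z. Qed.

Lemma mle_eq_lt x y : x <= y -> x < y \/ x = y.
Proof.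
move=> [z]; have [->|[u ->]] := zero_or_succ facts z.
  by move=> <-; right; ring.
move=> <-; left; exists u; rewrite (addxS facts).
by rewrite (addC facts (S u)) (addxS facts) (addC facts).
Qed.

Lemma mltW x y : x < y -> x <= y.
Proof. by apply: mle_trans; exists (S 0); rewrite (succE x); ring. Qed.

Lemma mlt0 x : ~ x < 0.
Proof. by move/mle0/(succ_neq0 facts). Qed.

Lemma mul_neq0 x y : x <> 0 -> y <> 0 -> x * y <> 0.
Proof.
have [->//|[u ->] _] := zero_or_succ facts x; have [->//|[v ->] _] := zero_or_succ facts y.
by rewrite (mulxS facts) (addxS facts); apply: (succ_neq0 facts).
Qed.

Lemma mdvd_mulr u y z : mdvd u y -> mdvd u (y * z).
Proof. by move=> [q <-]; exists (q * z); ring. Qed.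

(** The second half is required of every [b]: passing from [l] to its successor changes the [b] of
    the first half, and with it all the moduli. *)
Definition cut_J0 l :=
  (exists b, b <> 0 /\ forall j, j <= l -> mdvd j b) /\
  forall b, b <> 0 -> exists m, m <> 0 /\ forall j, j <= l -> mdvd (S j * b) m.

(** Shortening of [cut_J0] to a class closed under addition. It holds the lengths of segments, and
    two lengths must have a common upper bound in it. *)
Definition cut_J x := forall y, cut_J0 y -> cut_J0 (y + x).

Definition agree n a b a' b' := forall i, i < n -> (mmem i a b <-> mmem i a' b').

(** The part of the coded set below [n] is a node of the binary tree; it is extendible if good
    segments of every length in the cut pass through it. This replaces the infinite subtrees of
    König's lemma. *)
Definition extendible n a b :=
  forall l, cut_J l -> exists a' b', good l a' b' /\ agree n a b a' b'.

(* Leftmost for the lexicographic order of characteristic functions; this local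
   form makes uniqueness inherited from [n] to [n + 1], whereas a comparison at
   the first difference would require a least number principle in [M]. *)
Definition leftmost n a b := extendible n a b /\
  forall m, m < n -> mmem m a b ->
    ~ exists a' b', extendible (S m) a' b' /\ agree m a b a' b' /\ ~ mmem m a' b'.

(** That level [n] has a leftmost node, and only one as a set, cannot be proved by induction on [n];
    it is put into the definition, and closure under successor is proved instead. *)
Definition cut_K0 n := cut_J n /\ (exists a b, leftmost n a b) /\
  forall a b a' b', leftmost n a b -> leftmost n a' b' -> agree n a b a' b'.

(* Solovay's shortening: [cut_K1] is closed downwards, [cut_K2] also under
   addition, and [cut_K] also under multiplication. *)
Definition cut_K1 n := forall m, m <= n -> cut_K0 m.
Definition cut_K2 x := forall y, cut_K1 y -> cut_K1 (y + x).
Definition cut_K x := forall y, cut_K2 y -> cut_K2 (y * x).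

Definition path k := exists a b, leftmost (S k) a b /\ mmem k a b.

Lemma cut_J0_0 : cut_J0 0.
Proof.
split.
  exists (S 0); split; first exact: (succ_neq0 facts).
  by move=> j /mle0 ->; exists (S 0); ring.
move=> b _; exists (S (S 0 * b)); split; first exact: (succ_neq0 facts).
by move=> j /mle0 ->; exists (S 0); ring.
Qed.

(** Each common multiple is multiplied by the one new factor; neither a factorial nor a product over
    an interval is formed. *)
Lemma cut_J0_S l : cut_J0 l -> cut_J0 (S l).
Proof.
move=> [[b [b0 hb]] hm]; split.
  exists (b * S (S l)); split; first by apply: mul_neq0 => //; apply: (succ_neq0 facts).
  by move=> j /mle_succ_cases[/hb/mdvd_mulr //|->]; exists b.
move=> c c0; have [m [m0 h]] := hm c c0; exists (m * S (S (S l) * c)); split.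
  by apply: mul_neq0 => //; apply: (succ_neq0 facts).
by move=> j /mle_succ_cases[/h/mdvd_mulr //|->]; exists m.
Qed.

Lemma cut_J_0 : cut_J 0.
Proof. by move=> y; rewrite (addx0 facts). Qed.

Lemma cut_J_S x : cut_J x -> cut_J (S x).
Proof. by move=> h y hy; rewrite (addxS facts); apply/cut_J0_S/h. Qed.

Lemma cut_J_add x y : cut_J x -> cut_J y -> cut_J (x + y).
Proof. by move=> hx hy z hz; rewrite (addA facts); apply/hy/hx. Qed.

Lemma cut_J_J0 x : cut_J x -> cut_J0 x.
Proof. by move/(_ _ cut_J0_0); have -> : 0 + x = x by ring. Qed.

Lemma agree_mono m n a b a' b' : m <= n -> agree n a b a' b' -> agree m a b a' b'.
Proof. by move=> mn h i im; apply: h; apply: mle_trans mn. Qed.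

Lemma agree_sym n a b a' b' : agree n a b a' b' -> agree n a' b' a b.
Proof. by move=> h i /h ->. Qed.

Lemma agree_trans n a b a' b' a'' b'' :
  agree n a b a' b' -> agree n a' b' a'' b'' -> agree n a b a'' b''.
Proof. by move=> h h' i ni; rewrite h // h'. Qed.

Lemma agree_S n a b a' b' :
  agree n a b a' b' -> (mmem n a b <-> mmem n a' b') -> agree (S n) a b a' b'.
Proof. by move=> h hn i /mltS/mle_eq_lt[/h //|->]. Qed.

Lemma extendible_mono m n a b : m <= n -> extendible n a b -> extendible m a b.
Proof.
move=> mn h l /h[a' [b' [g ag]]]; exists a', b'; split=> //.
exact: agree_mono ag.
Qed.

Lemma leftmost_mono m n a b : m <= n -> leftmost n a b -> leftmost m a b.
Proof.
move=> mn [h1 h2]; split; first exact: extendible_mono h1.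
by move=> k km; apply: h2; apply: mle_trans mn.
Qed.

Hypothesis good_mono : forall n l a b, n <= l -> good l a b -> good n a b.
Hypothesis good_exists : forall n b m, codes_room n b m -> exists a, good n a b.

Lemma good_on_J l : cut_J l -> exists a b, good l a b.
Proof.
move/cut_J_J0 => [[b [b0 hb]] /(_ b b0)[m [m0 hm]]].
have [|a ha] := @good_exists l b m; last by exists a, b.
by split=> //; split=> // j jl; split; [apply: hb|apply: hm].
Qed.

Lemma cut_K0_0 : cut_K0 0.
Proof.
have no i (P : Prop) : i < 0 -> P by move/mlt0.
split; first exact: cut_J_0.
split=> [|a b a' b' _ _ i]; last exact: no.
exists 0, 0; split=> [l /good_on_J[a [b h]]|m]; last exact: no.
by exists a, b; split=> // i; apply: no.
Qed.

(** König's step. If neither value of the bit at [n] could be continued to all lengths, there would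
    be a length at which each value fails; a good segment of the sum of these two lengths has one of
    the values and restricts to both lengths. *)
Lemma extendible_next n a b : extendible n a b ->
  exists a' b', extendible (S n) a' b' /\ agree n a b a' b'.
Proof.
move=> ext.
have bit (v : Prop) : (forall l, cut_J l -> exists a' b',
      good l a' b' /\ agree n a b a' b' /\ (mmem n a' b' <-> v)) ->
    exists a' b', extendible (S n) a' b' /\ agree n a b a' b'.
  (* Length 0 is used only to obtain a pair that codes the new node; the other lengths show that
     this node is extendible. *)
  move=> h; have [a1 [b1 [_ [ag1 m1]]]] := h _ cut_J_0.
  exists a1, b1; split=> // l /h[a2 [b2 [g [ag2 m2]]]]; exists a2, b2; split=> //.
  apply: agree_S; last by rewrite m1 m2.
  exact: agree_trans (agree_sym ag1) ag2.
apply: NNPP => no.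
have fails (v : Prop) : exists l, cut_J l /\ ~ exists a' b',
    good l a' b' /\ agree n a b a' b' /\ (mmem n a' b' <-> v).
  apply: NNPP => no'; apply: no; apply: (bit v) => l hl.
  by apply: NNPP => no''; apply: no'; exists l.
(* The sum [l + k] stands in for the maximum of [l] and [k]. *)
have [l [hl nl]] := fails True; have [k [hk nk]] := fails False.
have [a' [b' [g ag]]] := ext _ (cut_J_add hl hk).
have [h|h] := classic (mmem n a' b').
  apply: nl; exists a', b'; split; last by split.
  by apply: good_mono g; apply: mle_addr.
apply: nk; exists a', b'; split; last by split.
by apply: good_mono g; apply: mle_addl.
Qed.

(** Existence: the successor node without [n] is taken if it is extendible, and otherwise the one
    from [extendible_next]. Uniqueness: if two leftmost nodes differed at [n], the one that lacks
    [n] would refute that the other is leftmost. *)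
Lemma cut_K0_S n : cut_K0 n -> cut_K0 (S n).
Proof.
move=> [Jn [[a [b [ext lm]]] uniq]]; split; first exact: cut_J_S.
split; last first.
  move=> a1 b1 a2 b2 h1 h2; have nS := mltW (mle_refl (S n)).
  have ag := uniq _ _ _ _ (leftmost_mono nS h1) (leftmost_mono nS h2).
  apply: agree_S => //; split=> hm; apply: NNPP => no.
    case: h1 => _ /(_ n (mle_refl _) hm); apply; exists a2, b2.
    by split; [case: h2|].
  case: h2 => _ /(_ n (mle_refl _) hm); apply; exists a1, b1.
  by split; [case: h1|split=> //; apply: agree_sym].
have transport a' b' : extendible (S n) a' b' -> agree n a b a' b' ->
    (mmem n a' b' -> ~ exists a'' b'', extendible (S n) a'' b'' /\
      agree n a b a'' b'' /\ ~ mmem n a'' b'') ->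
    exists a b, leftmost (S n) a b.
  move=> e ag h; exists a', b'; split=> // m /mltS/mle_eq_lt[mn|->] hm [a2 [b2 [e2 [ag2 nm]]]].
    apply: (lm m mn); first exact/ag.
    exists a2, b2; split=> //; split=> //.
    exact: agree_trans (agree_mono (mltW mn) ag) ag2.
  by apply: h => //; exists a2, b2; split=> //; split=> //; apply: agree_trans ag ag2.
have [[a1 [b1 [e1 [ag1 n1]]]]|no] := classic (exists a' b',
    extendible (S n) a' b' /\ agree n a b a' b' /\ ~ mmem n a' b').
  exact: transport e1 ag1 _.
have [a1 [b1 [e1 ag1]]] := extendible_next ext.
exact: transport e1 ag1 _.
Qed.

Lemma cut_K1_0 : cut_K1 0.
Proof. by move=> m /mle0 ->; apply: cut_K0_0. Qed.

Lemma cut_K1_S n : cut_K1 n -> cut_K1 (S n).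
Proof.
by move=> h m /mle_succ_cases[/h //|->]; apply/cut_K0_S/h/mle_refl.
Qed.

Lemma cut_K2_0 : cut_K2 0.
Proof. by move=> y; rewrite (addx0 facts). Qed.

Lemma cut_K2_S x : cut_K2 x -> cut_K2 (S x).
Proof. by move=> h y hy; rewrite (addxS facts); apply/cut_K1_S/h. Qed.

Lemma cut_K2_add x y : cut_K2 x -> cut_K2 y -> cut_K2 (x + y).
Proof. by move=> hx hy z hz; rewrite (addA facts); apply/hy/hx. Qed.

Lemma cut_K_0 : cut_K 0.
Proof. by move=> y _; rewrite (mulx0 facts); apply: cut_K2_0. Qed.

Lemma cut_K_S x : cut_K x -> cut_K (S x).
Proof. by move=> h y hy; rewrite (mulxS facts); apply: cut_K2_add => //; apply: h. Qed.

Lemma cut_K_add x y : cut_K x -> cut_K y -> cut_K (x + y).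
Proof.
move=> hx hy z hz; have -> : z * (x + y) = z * x + z * y by ring.
by apply: cut_K2_add; [apply: hx|apply: hy].
Qed.

Lemma cut_K_mul x y : cut_K x -> cut_K y -> cut_K (x * y).
Proof. by move=> hx hy z hz; rewrite (mulA facts); apply/hy/hx. Qed.

Lemma cut_K_K1 x : cut_K x -> cut_K1 x.
Proof.
have h1 : cut_K2 (S 0) by apply/cut_K2_S/cut_K2_0.
move/(_ _ h1)/(_ _ cut_K1_0).
by have -> : 0 + S 0 * x = x by ring.
Qed.

(** The leftmost node of level [n] has a good extension of length [n], which agrees with it below
    [n]. Its restriction to level [S k] is leftmost too, so uniqueness at that level identifies its
    bit at [k] with [path k]. *)
Lemma path_good n : cut_K n ->
  exists a b, good n a b /\ forall k, k < n -> (mmem k a b <-> path k).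
Proof.
move=> /cut_K_K1 Kn; have [Jn [[a [b lm]] _]] := Kn _ (mle_refl n).
have [ext _] := lm; have [a' [b' [g ag]]] := ext _ Jn.
exists a', b'; split=> // k kn; rewrite -(ag k kn).
have lmk := leftmost_mono kn lm.
split=> [h|[a2 [b2 [lm2 h]]]]; first by exists a, b.
have [_ [_ uniq]] := Kn _ kn.
by apply/(uniq _ _ _ _ lmk lm2); first exact: mle_refl.
Qed.

Lemma cut_K_bound (xs : seq M) : (forall x, List.In x xs -> cut_K x) ->
  exists2 n, cut_K n & forall x, List.In x xs -> x < n.
Proof.
elim: xs => [|x xs IH] h; first by exists 0; [apply: cut_K_0|].
have [|n Kn hn] := IH; first by move=> y hy; apply: h; right.
exists (S x + n) => [|y /= [<-|/hn yn]].
- by apply: cut_K_add => //; apply/cut_K_S/h; left.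
- exact: mle_addr.
- exact: mle_trans yn (mle_addl _ _).
Qed.

End Cuts.

(** * Definability *)

Lemma forall_iff (A : Type) (P Q : A -> Prop) :
  (forall x, P x <-> Q x) -> (forall x, P x) <-> (forall x, Q x).
Proof. by move=> h; split=> H x; apply/h. Qed.

Lemma sat_Ex_iff (S : signature) (M : structure S) (e : nat -> M) p (Q : M -> Prop) :
  (forall x, sat (scons x e) p <-> Q x) -> sat e (Ex p) <-> exists x, Q x.
Proof. by move=> h; rewrite sat_Ex; split=> -[x hx]; exists x; apply/h. Qed.

Lemma and_iff_compat (A B C D : Prop) :
  (A <-> B) -> (C <-> D) -> (A /\ C) <-> (B /\ D).
Proof. by move=> -> ->. Qed.

Lemma sat_All_iff (S : signature) (M : structure S) (e : nat -> M) p (Q : M -> Prop) :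
  (forall x, sat (scons x e) p <-> Q x) -> sat e (All p) <-> forall x, Q x.
Proof. exact: forall_iff. Qed.

Section ArithTerms.
Variables (M : structure arith) (e : nat -> M).

Lemma teval_arith_app (f : arith_fn) ts :
  size ts = far (f : fn arith) -> teval e (arith_app f ts) = fnI (f : fn arith) (map (teval e) ts).
Proof.
move=> sz; rewrite /=; congr fnI; set l := (X in X = _).
have szl : size l = far (f : fn arith) by rewrite size_map size_enum_ord.
apply: (@eq_from_nth _ (e 0)); rewrite szl ?size_map // => i lt.
rewrite (nth_map (Var 0)) ?sz // (nth_map (Ordinal lt)) ?size_enum_ord // ffunE /=.
by rewrite nth_enum_ord.
Qed.

Lemma teval_zero : teval e tzero = mzero.
Proof. exact: teval_arith_app. Qed.

Lemma teval_succ t : teval e (tsucc t) = msucc (teval e t).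
Proof. exact: teval_arith_app. Qed.

Lemma teval_plus t u : teval e (tplus t u) = madd (teval e t) (teval e u).
Proof. exact: teval_arith_app. Qed.

Lemma teval_times t u : teval e (ttimes t u) = mmul (teval e t) (teval e u).
Proof. exact: teval_arith_app. Qed.

Definition tevalE := (teval_zero, teval_succ, teval_plus, teval_times, teval_tshift).

End ArithTerms.

Lemma tsubst_arith_app s (f : arith_fn) ts :
  size ts = far (f : fn arith) -> tsubst s (arith_app f ts) = arith_app f (map (tsubst s) ts).
Proof.
move=> sz; congr App; apply/ffunP=> i; rewrite !ffunE (nth_map (Var 0)) // sz.
exact: ltn_ord.
Qed.

(* [Le] and unbounded divisibility are not syntactically [Delta0]. *)
Definition Bex t p := Not (Ball t (Not p)).
Definition leF (t u : term arith) := Bex u (Eq (tplus (Var 0) (tshift t)) (tshift u)).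
Definition dvdF (u y : term arith) := Bex y (Eq (ttimes (Var 0) (tsucc (tshift u))) (tshift y)).
Definition memF k a b := dvdF (ttimes (tsucc k) b) a.

Lemma Delta0_Not p : Delta0 p -> Delta0 (Not p).
Proof. by move=> h; apply: Delta0_Imp h Delta0_Bot. Qed.

Lemma Delta0_And p q : Delta0 p -> Delta0 q -> Delta0 (And p q).
Proof. by move=> hp hq; apply/Delta0_Not/Delta0_Imp/Delta0_Not. Qed.

Lemma Delta0_Bex t p : Delta0 p -> Delta0 (Bex t p).
Proof. by move=> h; apply/Delta0_Not/Delta0_Ball/Delta0_Not. Qed.

Lemma Delta0_leF t u : Delta0 (leF t u).
Proof. exact/Delta0_Bex/Delta0_Eq. Qed.

Lemma Delta0_dvdF t u : Delta0 (dvdF t u).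
Proof. exact/Delta0_Bex/Delta0_Eq. Qed.

Lemma Delta0_subst s p : Delta0 p -> Delta0 (subst s p).
Proof.
move=> h; elim: h s => {p} [|t u|p q _ IHp _ IHq|t p _ IH] s /=.
- exact: Delta0_Bot.
- exact: Delta0_Eq.
- exact: Delta0_Imp.
(* After substitution the guard has to be recognised as [Le (Var 0) (tshift _)] again, so that
   [Delta0_Ball] applies. *)
have -> : forall q, Imp (Imp (All (Imp (Eq
     (tsubst (up (up s)) (tplus (Var 0) (tshift (Var 0))))
     (tsubst (up (up s)) (tshift (tshift t)))) Bot)) Bot) q
   = Imp (Le (Var 0) (tshift (tsubst s t))) q.
  move=> q; congr (Imp (Ex (Eq _ _)) _); first by rewrite tsubst_arith_app.
  by rewrite /tshift !tsubst_comp; apply: tsubst_ext => x; rewrite /= /tshift !tsubst_comp.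
exact: Delta0_Ball.
Qed.

(** * Formulas for clauses, cuts and the path *)

Fixpoint balls d v p := if d is d'.+1 then Ball (Var v) (balls d' v.+1 p) else p.

Lemma Delta0_balls d v p : Delta0 p -> Delta0 (balls d v p).
Proof. by move=> h; elim: d v => //= d IH v; apply: Delta0_Ball. Qed.

(* A clause [(d, ls)] stands for the disjunction of the literals [ls], with [d]
   universally quantified variables; the literal [(true, t)] says that (the
   value of) [t] belongs to a given set, and [(false, t)] that it does not. *)
Definition clause : Type := nat * seq (bool * term arith).

(** As a substitution it sends every variable from [d] on to zero. The bounds on free variables
    demanded of sentences and of translations thus hold by construction, without inspecting the
    large formulas concerned. *)
Definition only d i : term arith := if i < d then Var i else tzero.

Lemma below_only d p : below d (subst (only d) p).
Proof.
have [n hn] := below_exists p; apply: below_subst hn _ => x _; rewrite /only.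
by case: ifP => //= _; apply/forallP => -[].
Qed.

Definition lit_term d (l : bool * term arith) := tsubst (only d) l.2.

(** One link in a chain of implications: [p] is required only if the value of the literal is within
    the bound and the literal fails. Folded down to [Bot], the chain expresses the disjunction under
    the assumption that all values are at most [n]. *)
Definition litF d n a b l p :=
  Imp (leF (lit_term d l) (Var (d + n)))
    (Imp (Not (let m := memF (lit_term d l) (Var (d + a)) (Var (d + b)) in
               if l.1 then m else Not m)) p).

Definition clauseF (c : clause) n a b :=
  balls c.1 n (foldr (litF c.1 n a b) Bot c.2).

Definition goodF (C : seq clause) n a b := bigAnd [seq clauseF c n a b | c <- C].

Lemma Delta0_goodF C n a b : Delta0 (goodF C n a b).
Proof.
rewrite /goodF; elim: C => [|[d ls] C IH] /=; first exact/Delta0_Not/Delta0_Bot.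
apply: Delta0_And => //; apply: Delta0_balls => {C IH}.
elim: ls => [|[v t] ls IH] /=; first exact: Delta0_Bot.
apply: Delta0_Imp; first exact: Delta0_leF.
apply: Delta0_Imp => //; apply: Delta0_Not.
by case: v; [|apply: Delta0_Not]; apply: Delta0_dvdF.
Qed.

Definition lit_val (M : structure arith) (xs : seq M) (l : bool * term arith) :=
  teval (nth mzero xs) l.2.

(** A clause is tested only where its variables and the values of its literals are at most [n]. The
    condition is therefore inherited by smaller [n], and expressible with bounded quantifiers. *)
Definition good (M : structure arith) (C : seq clause) (n a b : M) :=
  forall c, List.In c C -> forall xs, size xs = c.1 ->
  (forall x, List.In x xs -> mle x n) ->
  (forall l, List.In l c.2 -> mle (lit_val xs l) n) ->
  exists l, List.In l c.2 /\ (mmem (lit_val xs l) a b <-> l.1).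

Definition roomF n b m :=
  And (Not (Eq (Var b) tzero)) (And (Not (Eq (Var m) tzero))
    (Ball (Var n) (And (dvdF (Var 0) (Var b.+1))
                       (dvdF (ttimes (tsucc (Var 0)) (Var b.+1)) (Var m.+1))))).

(** Variables 0, 1, 2 are [n], [b], [m]; under the quantifier for the code, which becomes variable
    0, they move up by one. The bound [m] on the code keeps the formula [Delta0]. *)
Definition mainF C := Imp (roomF 0 1 2) (Bex (Var 2) (goodF C 1 0 2)).

(** This formula and the next ones transcribe the notions for cuts. Their arguments are indices of
    variables, raised under each quantifier; a compound argument enters by [subst0], inside which
    the other indices are one higher because [subst0] lowers them. *)
Definition J0F l :=
  And (Ex (And (Not (Eq (Var 0) tzero))
        (All (Imp (leF (Var 0) (Var l.+2)) (dvdF (Var 0) (Var 1))))))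
      (All (Imp (Not (Eq (Var 0) tzero)) (Ex (And (Not (Eq (Var 0) tzero))
        (All (Imp (leF (Var 0) (Var l.+3)) (dvdF (ttimes (tsucc (Var 0)) (Var 2)) (Var 1)))))))).

Definition JF x := All (Imp (J0F 0) (subst0 (tplus (Var 0) (Var x.+1)) (J0F 0))).

Definition agreeF n a b a' b' :=
  All (Imp (leF (tsucc (Var 0)) (Var n.+1))
    (And (Imp (memF (Var 0) (Var a.+1) (Var b.+1)) (memF (Var 0) (Var a'.+1) (Var b'.+1)))
         (Imp (memF (Var 0) (Var a'.+1) (Var b'.+1)) (memF (Var 0) (Var a.+1) (Var b.+1))))).

Section CutFormulas.
Variable C : seq clause.

Definition extF n a b :=
  All (Imp (JF 0) (Ex (Ex (And (goodF C 2 1 0) (agreeF n.+3 a.+3 b.+3 1 0))))).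

Definition leftmostF n a b := And (extF n a b)
  (All (Imp (leF (tsucc (Var 0)) (Var n.+1)) (Imp (memF (Var 0) (Var a.+1) (Var b.+1))
    (Not (Ex (Ex (And (subst0 (tsucc (Var 2)) (extF 0 2 1))
      (And (agreeF 2 a.+3 b.+3 1 0) (Not (memF (Var 2) (Var 1) (Var 0))))))))))).

Definition K0F n := And (JF n) (And (Ex (Ex (leftmostF n.+2 1 0)))
  (Alls 4 (Imp (leftmostF n.+4 3 2) (Imp (leftmostF n.+4 1 0) (agreeF n.+4 3 2 1 0))))).

Definition K1F n := All (Imp (leF (Var 0) (Var n.+1)) (K0F 0)).
Definition K2F x := All (Imp (K1F 0) (subst0 (tplus (Var 0) (Var x.+1)) (K1F 0))).
Definition KF x := All (Imp (K2F 0) (subst0 (ttimes (Var 0) (Var x.+1)) (K2F 0))).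

Definition pathF k :=
  Ex (Ex (And (subst0 (tsucc (Var k.+2)) (leftmostF 0 2 1)) (memF (Var k.+2) (Var 1) (Var 0)))).

End CutFormulas.

Section SatFormulas.
Variables (M : structure arith) (nM : normal M) (facts : arith_facts M).
Implicit Types (e : nat -> M).

Lemma sat_Eq e t u : sat e (Eq t u) <-> teval e t = teval e u.
Proof. exact: nM. Qed.

Lemma sat_Ball e t p :
  sat e (Ball t p) <-> forall x, mle x (teval e t) -> sat (scons x e) p.
Proof.
apply: sat_All_iff => x; rewrite sat_Imp.
suff -> : sat (scons x e) (Le (Var 0) (tshift t)) <-> mle x (teval e t) by [].
by apply: sat_Ex_iff => z; rewrite sat_Eq !tevalE.
Qed.

Lemma sat_Bex e t p :
  sat e (Bex t p) <-> exists x, mle x (teval e t) /\ sat (scons x e) p.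
Proof.
rewrite sat_Not sat_Ball; split=> [h|[x [hx hp]] h]; last exact: h hx hp.
by apply: NNPP => no; apply: h => x hx hp; apply: no; exists x.
Qed.

Lemma sat_leF e t u : sat e (leF t u) <-> mle (teval e t) (teval e u).
Proof.
rewrite sat_Bex; split=> -[z].
  by rewrite sat_Eq !tevalE => -[_ h]; exists z.
move=> h; exists z; rewrite sat_Eq !tevalE; split=> //.
by exists (teval e t); rewrite (addC facts).
Qed.

Lemma sat_dvdF e t u : sat e (dvdF t u) <-> mdvd (teval e t) (teval e u).
Proof.
rewrite sat_Bex; split=> -[z].
  by rewrite sat_Eq !tevalE => -[_ h]; exists z.
move=> h; exists z; rewrite sat_Eq !tevalE; split=> //.
by exists (mmul z (teval e t)); rewrite -(mulxS facts).
Qed.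

Lemma sat_memF e t u v : sat e (memF t u v) <-> mmem (teval e t) (teval e u) (teval e v).
Proof. by rewrite sat_dvdF !tevalE. Qed.

Lemma sat_balls e d v p :
  sat e (balls d v p) <-> forall xs, size xs = d ->
    (forall x, List.In x xs -> mle x (e v)) -> sat (env_cat xs e) p.
Proof.
elim: d e v => [|d IH] e v.
  have E : env_cat [::] e =1 e by move=> j; rewrite /env_cat nth_nil subn0.
  split=> [h xs /size0nil -> _|/(_ [::] erefl) h]; first exact/(sat_ext _ E).
  by apply/(sat_ext _ E)/h.
rewrite [balls _ _ _]/(Ball (Var v) (balls d v.+1 p)) sat_Ball; split=> [h xs|h x xe].
  case/lastP: xs => // xs x; rewrite size_rcons => -[sz] hx.
  apply/(sat_ext _ (env_cat_rcons _ _ _)); have xe : mle x (e v).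
    by apply: hx; rewrite -cats1; apply/List.in_app_iff; right; left.
  apply: (iffLR (IH _ _) (h x xe) xs sz) => y hy; apply: hx.
  by rewrite -cats1; apply/List.in_app_iff; left.
apply/IH => xs sz hx; apply/(sat_ext _ (env_cat_rcons _ _ _)).
apply: h; first by rewrite size_rcons sz.
by move=> y; rewrite -cats1 => /List.in_app_iff[/hx //|[<-|[]]].
Qed.

Lemma teval_lit_term (xs : seq M) e l :
  teval (env_cat xs e) (lit_term (size xs) l) = lit_val xs l.
Proof.
rewrite teval_tsubst; apply: teval_ext => i; rewrite /only; case: ifP => h.
  exact: env_cat_lt.
by rewrite teval_zero nth_default // leqNgt h.
Qed.

Lemma sat_litF e (xs : seq M) n a b l p :
  sat (env_cat xs e) (litF (size xs) n a b l p) <->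
  (mle (lit_val xs l) (e n) -> ~ (mmem (lit_val xs l) (e a) (e b) <-> l.1) ->
   sat (env_cat xs e) p).
Proof.
rewrite /litF sat_Imp sat_leF sat_Imp sat_Not teval_lit_term [teval _ (Var _)]/= env_cat_ge //.
apply: imp_iff_compat_l; case: l.1.
  rewrite sat_memF teval_lit_term /= !env_cat_ge //.
  by split=> h h2; apply: h => h3; apply: h2; intuition.
rewrite sat_Not sat_memF teval_lit_term /= !env_cat_ge //.
by split=> h h2; apply: h => h3; apply: h2; intuition.
Qed.

Lemma sat_goodF C e n a b : sat e (goodF C n a b) <-> good C (e n) (e a) (e b).
Proof.
rewrite sat_bigAnd; have clE c : sat e (clauseF c n a b) <->
    forall xs, size xs = c.1 -> (forall x, List.In x xs -> mle x (e n)) ->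
    (forall l, List.In l c.2 -> mle (lit_val xs l) (e n)) ->
    exists l, List.In l c.2 /\ (mmem (lit_val xs l) (e a) (e b) <-> l.1).
  case: c => d ls; rewrite /clauseF sat_balls; apply: forall_iff => xs /=.
  split=> h sz hx; move: (h sz hx); rewrite -{d}sz in h *.
    elim: ls {h} => [//|l ls IH].
    rewrite [foldr _ _ _]/(litF (size xs) n a b l (foldr (litF (size xs) n a b) Bot ls)) sat_litF.
    move=> h hl; have [m|nm] := classic (mmem (lit_val xs l) (e a) (e b) <-> l.1).
      by exists l; split=> //; left.
    have [|l' [h1 h2]] := IH (h (hl l (or_introl erefl)) nm).
      by move=> l' hl'; apply: hl; right.
    by exists l'; split=> //; right.
  elim: ls {h} => [|l ls IH] h; first by case: h => // l [].
  rewrite [foldr _ _ _]/(litF (size xs) n a b l (foldr (litF (size xs) n a b) Bot ls)) sat_litF.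
  move=> hl nl; apply: IH => hls.
  have [|l' [/= [<-|h1] h2]] := h; last by exists l'.
    by move=> l' /= [<-|/hls].
  by case: nl.
split=> [h c hc|h p /List.in_map_iff[c [<- hc]]]; last exact/clE/h.
by apply/clE/h; apply: (List.in_map (fun c => clauseF c n a b)).
Qed.

Lemma sat_roomF e n b m : sat e (roomF n b m) <-> codes_room (e n) (e b) (e m).
Proof.
rewrite !sat_And !sat_Not !sat_Eq sat_Ball teval_zero /=.
suff -> : (forall x, mle x (e n) -> sat (scons x e) (And (dvdF (Var 0) (Var b.+1))
    (dvdF (ttimes (tsucc (Var 0)) (Var b.+1)) (Var m.+1)))) <->
  (forall j, mle j (e n) -> mdvd j (e b) /\ mdvd (mmul (msucc j) (e b)) (e m)) by [].
by apply: forall_iff => x; rewrite sat_And !sat_dvdF !tevalE.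
Qed.

Lemma sat_mainF C e : sat e (mainF C) <->
  (codes_room (e 0) (e 1) (e 2) -> exists a, mle a (e 2) /\ good C (e 0) a (e 1)).
Proof.
rewrite sat_Imp sat_roomF sat_Bex /=.
suff -> : (exists x, mle x (e 2) /\ sat (scons x e) (goodF C 1 0 2)) <->
  (exists a, mle a (e 2) /\ good C (e 0) a (e 1)) by [].
by split=> -[a [h1 h2]]; exists a; split=> //; [move/sat_goodF: h2 | apply/sat_goodF].
Qed.

Lemma sat_subst0 e t p : sat e (subst0 t p) <-> sat (scons (teval e t) e) p.
Proof. by rewrite sat_subst; apply: sat_ext => -[]. Qed.

Lemma sat_J0F e l : sat e (J0F l) <-> cut_J0 (e l).
Proof.
rewrite sat_And; apply: and_iff_compat; last first.
- apply: sat_All_iff => b; rewrite sat_Imp sat_Not sat_Eq teval_zero.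
  apply: imp_iff_compat_l; apply: sat_Ex_iff => m.
  rewrite sat_And sat_Not sat_Eq teval_zero; apply: and_iff_compat_l.
  by apply: sat_All_iff => j; rewrite sat_Imp sat_leF sat_dvdF ?tevalE.
- apply: sat_Ex_iff => b.
  rewrite sat_And sat_Not sat_Eq teval_zero; apply: and_iff_compat_l.
  by apply: sat_All_iff => j; rewrite sat_Imp sat_leF sat_dvdF ?tevalE.
Qed.

Lemma sat_JF e x : sat e (JF x) <-> cut_J (e x).
Proof.
by apply: sat_All_iff => y; rewrite sat_Imp sat_subst0 !sat_J0F teval_plus.
Qed.

Lemma sat_agreeF e n a b a' b' :
  sat e (agreeF n a b a' b') <-> agree (e n) (e a) (e b) (e a') (e b').
Proof.
apply: sat_All_iff => i.
rewrite sat_Imp sat_leF sat_And ?tevalE; apply: imp_iff_compat_l.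
by apply: and_iff_compat; rewrite sat_Imp !sat_memF.
Qed.

Variable C : seq clause.
Local Notation good := (@good M C).

Lemma sat_extF e n a b : sat e (extF C n a b) <-> extendible good (e n) (e a) (e b).
Proof.
apply: sat_All_iff => l; rewrite sat_Imp sat_JF; apply: imp_iff_compat_l.
apply: sat_Ex_iff => a'; apply: sat_Ex_iff => b'.
by rewrite sat_And sat_goodF sat_agreeF.
Qed.

Lemma sat_leftmostF e n a b : sat e (leftmostF C n a b) <-> leftmost good (e n) (e a) (e b).
Proof.
rewrite sat_And sat_extF; apply: and_iff_compat_l.
apply: sat_All_iff => m; rewrite sat_Imp sat_leF sat_Imp sat_memF ?tevalE sat_Not.
do 2!apply: imp_iff_compat_l; apply: not_iff_compat.
apply: sat_Ex_iff => a'; apply: sat_Ex_iff => b'.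
by rewrite !sat_And sat_subst0 sat_extF sat_agreeF sat_Not sat_memF ?tevalE.
Qed.

Lemma sat_K0F e n : sat e (K0F C n) <-> cut_K0 good (e n).
Proof.
rewrite !sat_And sat_JF; apply: and_iff_compat_l; apply: and_iff_compat.
  by apply: sat_Ex_iff => a; apply: sat_Ex_iff => b; rewrite sat_leftmostF.
do 4!apply: sat_All_iff => ?.
by rewrite sat_Imp sat_leftmostF sat_Imp sat_leftmostF sat_agreeF.
Qed.

Lemma sat_K1F e n : sat e (K1F C n) <-> cut_K1 good (e n).
Proof. by apply: sat_All_iff => m; rewrite sat_Imp sat_leF sat_K0F. Qed.

Lemma sat_K2F e x : sat e (K2F C x) <-> cut_K2 good (e x).
Proof. by apply: sat_All_iff => y; rewrite sat_Imp sat_subst0 !sat_K1F teval_plus. Qed.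

Lemma sat_KF e x : sat e (KF C x) <-> cut_K good (e x).
Proof. by apply: sat_All_iff => y; rewrite sat_Imp sat_subst0 !sat_K2F teval_times. Qed.

Lemma sat_pathF e k : sat e (pathF C k) <-> path good (e k).
Proof.
apply: sat_Ex_iff => a; apply: sat_Ex_iff => b.
by rewrite sat_And sat_subst0 sat_leftmostF sat_memF ?tevalE.
Qed.

End SatFormulas.

(** * The standard model *)

Definition Nat : structure arith := @Structure arith nat
  (fun f xs => match f with
     | Zero => 0
     | Succ => (nth 0 xs 0).+1
     | Plus => nth 0 xs 0 + nth 0 xs 1
     | Times => nth 0 xs 0 * nth 0 xs 1 end)
  (fun R => match R with end) eq.

Lemma normal_Nat : normal Nat.
Proof. by []. Qed.

Lemma eval_Nat (e : nat -> Nat) t : eval e t = teval e t.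
Proof.
elim/term_ffun_ind: t => [x|f ts IH] //=.
have nthE n (g : 'I_n -> nat) (i : 'I_n) : nth 0 [seq g j | j <- enum 'I_n] i = g i.
  by rewrite (nth_map i) ?size_enum_ord // nth_ord_enum.
case: f ts IH => ts IH //=.
- by rewrite (nthE 1 (fun i => teval e (ts i)) ord0) IH.
- rewrite (nthE 2 (fun i => teval e (ts i)) ord0) (nthE 2 (fun i => teval e (ts i)) ord_max).
  by rewrite !IH.
- rewrite (nthE 2 (fun i => teval e (ts i)) ord0) (nthE 2 (fun i => teval e (ts i)) ord_max).
  by rewrite !IH.
Qed.

Lemma holds_Nat (e : nat -> Nat) p : holds e p <-> sat e p.
Proof.
elim: p e => [|t u|[]|p IHp q IHq|p IH] e //=.
- by rewrite !eval_Nat.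
- by rewrite IHp IHq.
- by apply: forall_iff => n; apply: IH.
Qed.

Lemma arith_facts_Nat : arith_facts Nat.
Proof.
split; rewrite /madd /mmul /msucc /mzero /=.
- by [].
- by move=> x y [].
- by case=> [|x]; [left|right; exists x].
- exact: addn0.
- exact: addnS.
- exact: muln0.
- by move=> x y; rewrite mulnS addnC.
- exact: addnC.
- exact: addnA.
- exact: mulnC.
- exact: mulnA.
- exact: mulnDl.
Qed.

Lemma mle_Nat (x y : Nat) : mle x y <-> x <= y.
Proof.
split=> [[z <-]|h]; first exact: leq_addl.
by exists (y - x); apply: subnK.
Qed.

Lemma mdvd_Nat (x y : Nat) : mdvd x y <-> x.+1 %| y.
Proof. by split=> [[q <-]|/dvdnP[q ->]]; [apply: dvdn_mull|exists q]. Qed.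

(** * Coding finite sets by divisibility *)

Section Beta.
Variables n b : nat.
Hypotheses (b0 : 0 < b) (hb : forall j, j <= n -> j.+1 %| b).
Let d j := (j.+1 * b).+1.

(** A common divisor of the two moduli divides (j - i) b and is coprime to [b], hence divides j - i.
    As j - i is among 1, ..., n + 1, it divides [b], so the common divisor is 1. *)
Lemma coprime_beta i j : i <= n -> j <= n -> i != j -> coprime (d i) (d j).
Proof.
wlog lt : i j / i < j.
  move=> W; case: (ltngtP i j) => [lt|lt|->] // hi hj _; first by apply: W; rewrite ?ltn_eqF.
  by rewrite coprime_sym; apply: W; rewrite ?ltn_eqF.
move=> _ jn _; rewrite /coprime; set g := gcdn _ _.
have gi : g %| d i by apply: dvdn_gcdl.
have gj : g %| d j by apply: dvdn_gcdr.
have cop : coprime g b.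
  apply: (coprime_dvdl gi); rewrite /d -addn1 coprime_sym.
  by rewrite /coprime gcdnMDl gcdn1.
have : g %| (j - i) * b.
  have -> : (j - i) * b = d j - d i by rewrite /d subSS -mulnBl subSS.
  exact: dvdn_sub.
rewrite Gauss_dvdl // => gji.
have gb : g %| b.
  apply: dvdn_trans gji _; rewrite -(prednK (n := j - i)) ?subn_gt0 //.
  by apply: hb; apply: leq_trans (leq_pred _) (leq_trans (leq_subr _ _) jn).
by move: cop; rewrite /coprime => /eqP <-; rewrite gcdnC; apply/eqP/esym/gcdn_idPr.
Qed.

(** The code is the product of the moduli with index in [X]. By coprimality it divides [m], hence is
    at most [m], and a modulus with index outside [X] is coprime to it, therefore no divisor, being
    greater than 1. *)
Lemma beta_code m (X : pred nat) : 0 < m -> (forall j, j <= n -> d j %| m) ->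
  exists2 a, a <= m & forall k, k <= n -> (d k %| a) = X k.
Proof.
move=> m0 hm; pose A N := \prod_(j < N | X j) d j.
have copA N k : N <= n.+1 -> k <= n -> (forall j : 'I_N, X j -> val j != k) -> coprime (A N) (d k).
  move=> Nn kn h; rewrite /A; elim/big_rec: _ => [|j x Xj IH]; first exact: coprime1n.
  rewrite coprimeMl IH andbT; apply: coprime_beta (h _ Xj) => //.
  by rewrite -ltnS; apply: leq_trans (ltn_ord j) Nn.
have dvdA N : N <= n.+1 -> A N %| m.
  elim: N => [|N IH] lt; first by rewrite /A big_ord0 dvd1n.
  rewrite /A big_mkcond big_ord_recr /= -big_mkcond -/(A N).
  case: ifP => _; last by rewrite muln1; apply/IH/ltnW.
  rewrite Gauss_dvd; first by rewrite IH ?(ltnW lt) // hm.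
  by apply: copA; [apply: ltnW | | move=> j _; rewrite neq_ltn [val j < N]ltn_ord].
exists (A n.+1); first by apply: dvdn_leq => //; apply: dvdA.
move=> k kn; case Xk: (X k).
  by rewrite /A (bigD1 (Ordinal (kn : k < n.+1))) //=; apply/dvdn_mulr/dvdnn.
apply/negP => dk.
have : coprime (A n.+1) (d k).
  by apply: copA => // j Xj; apply/negP => /eqP jk; rewrite jk Xk in Xj.
move/(coprime_dvdl dk); rewrite /coprime gcdnn /d eqSS muln_eq0 /=.
by rewrite eqn0Ngt b0.
Qed.

End Beta.

(** * The arithmetical axioms *)

Definition closeF k p : form arith := Alls k (subst (only k) p).

Lemma sentence_closeF k p : sentence (closeF k p).
Proof. by rewrite /sentence below_Alls addn0 below_only. Qed.

Lemma Pi1_closeF k p : Delta0 p -> Pi1 (closeF k p).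
Proof.
move=> hp; have h : Pi1 (subst (only k) p) by apply/Pi1_Delta0/Delta0_subst.
by rewrite /closeF; elim: k (subst _ p) h => //= k IH q hq; apply/Pi1_All/IH.
Qed.

Lemma sat_closeF (M : structure arith) (e : nat -> M) k p :
  sat e (closeF k p) <->
  forall xs, size xs = k -> sat (fun j => teval (env_cat xs e) (only k j)) p.
Proof. by rewrite sat_Alls; split=> h xs sx; apply/sat_subst/h. Qed.

Definition ring_axioms : seq (form arith) :=
  let x := Var 0 in let y := Var 1 in let z := Var 2 in
  [:: closeF 2 (Eq (tplus x y) (tplus y x));
      closeF 3 (Eq (tplus x (tplus y z)) (tplus (tplus x y) z));
      closeF 2 (Eq (ttimes x y) (ttimes y x));
      closeF 3 (Eq (ttimes x (ttimes y z)) (ttimes (ttimes x y) z));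
      closeF 3 (Eq (ttimes (tplus x y) z) (tplus (ttimes x z) (ttimes y z)))].

Definition coding_axioms C := rcons ring_axioms (closeF 3 (mainF C)).

Section ArithTheory.
Variables (M : structure arith) (nM : normal M).

Lemma sat_Q_axioms (e : nat -> M) :
  (forall p, List.In p Q_axioms -> sat e p) <->
  [/\ forall x : M, msucc x <> mzero,
      forall x y : M, msucc x = msucc y -> x = y,
      forall x : M, x <> mzero -> exists y, x = msucc y,
      forall x : M, madd x mzero = x &
      [/\ forall x y : M, madd x (msucc y) = msucc (madd x y),
          forall x : M, mmul x mzero = mzero &
          forall x y : M, mmul x (msucc y) = madd (mmul x y) x]].
Proof.
split=> [h|[h1 h2 h3 h4 [h5 h6 h7]] p].
  have {}h k p : nth (Not Bot) Q_axioms k = p -> sat e p.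
    move=> <-; move: k => [|[|[|[|[|[|[|k]]]]]]]; try by apply: h; rewrite /= ; tauto.
    by rewrite nth_default //=.
  split; last split.
  - move=> x; have : sat (scons x e) (Not (Eq (tsucc (Var 0)) tzero)) := h 0 _ erefl x.
    by rewrite sat_Not (sat_Eq nM) !tevalE.
  - move=> x y; have : sat (scons y (scons x e))
        (Imp (Eq (tsucc (Var 1)) (tsucc (Var 0))) (Eq (Var 1) (Var 0))) := h 1 _ erefl x y.
    by rewrite sat_Imp !(sat_Eq nM) !tevalE.
  - move=> x; have : sat (scons x e) (Imp (Not (Eq (Var 0) tzero))
        (Ex (Eq (Var 1) (tsucc (Var 0))))) := h 2 _ erefl x.
    rewrite sat_Imp sat_Not (sat_Eq nM) !tevalE => H /H /sat_Ex[y].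
    by rewrite (sat_Eq nM) !tevalE => hy; exists y.
  - move=> x; have : sat (scons x e) (Eq (tplus (Var 0) tzero) (Var 0)) := h 3 _ erefl x.
    by rewrite (sat_Eq nM) !tevalE.
  - move=> x y; have : sat (scons y (scons x e)) (Eq (tplus (Var 1) (tsucc (Var 0)))
        (tsucc (tplus (Var 1) (Var 0)))) := h 4 _ erefl x y.
    by rewrite (sat_Eq nM) !tevalE.
  - move=> x; have : sat (scons x e) (Eq (ttimes (Var 0) tzero) tzero) := h 5 _ erefl x.
    by rewrite (sat_Eq nM) !tevalE.
  - move=> x y; have : sat (scons y (scons x e)) (Eq (ttimes (Var 1) (tsucc (Var 0)))
        (tplus (ttimes (Var 1) (Var 0)) (Var 1))) := h 6 _ erefl x y.
    by rewrite (sat_Eq nM) !tevalE.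
move=> /= [<-|[<-|[<-|[<-|[<-|[<-|[<-|//]]]]]]].
- apply: (iffRL (sat_Alls 1 e _)) => -[|x []] // _.
  by rewrite sat_Not (sat_Eq nM) !tevalE; apply: h1.
- apply: (iffRL (sat_Alls 2 e _)) => -[|y [|x []]] // _.
  by rewrite sat_Imp !(sat_Eq nM) !tevalE; apply: h2.
- apply: (iffRL (sat_Alls 1 e _)) => -[|x []] // _.
  rewrite sat_Imp sat_Not (sat_Eq nM) !tevalE => /h3[y hy].
  by apply/sat_Ex; exists y; rewrite (sat_Eq nM) !tevalE.
- apply: (iffRL (sat_Alls 1 e _)) => -[|x []] // _.
  by rewrite (sat_Eq nM) !tevalE; apply: h4.
- apply: (iffRL (sat_Alls 2 e _)) => -[|y [|x []]] // _.
  by rewrite (sat_Eq nM) !tevalE; apply: h5.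
- apply: (iffRL (sat_Alls 1 e _)) => -[|x []] // _.
  by rewrite (sat_Eq nM) !tevalE; apply: h6.
- apply: (iffRL (sat_Alls 2 e _)) => -[|y [|x []]] // _.
  by rewrite (sat_Eq nM) !tevalE; apply: h7.
Qed.

Lemma sat_coding_axioms C (e : nat -> M) : (forall p, List.In p Q_axioms -> sat e p) ->
  (forall p, List.In p (coding_axioms C) -> sat e p) <->
  arith_facts M /\ forall n b m : M, codes_room n b m -> exists a, mle a m /\ good C n a b.
Proof.
move/sat_Q_axioms => [h1 h2 h3 h4 [h5 h6 h7]].
split=> [h|[facts h] p].
  have facts : arith_facts M.
    have {}h k p : nth (Not Bot) ring_axioms k = p -> sat e p.
      move=> <-; move: k => [|[|[|[|[|k]]]]]; try by apply: h; rewrite /=; tauto.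
      by rewrite nth_default //=.
    split=> //.
    - by move=> x; have [->|/h3] := classic (x = mzero); [left|right].
    - move=> x y; have /sat_closeF/(_ [:: x; y] erefl) := h 0 _ erefl.
      by rewrite (sat_Eq nM) !tevalE.
    - move=> x y z; have /sat_closeF/(_ [:: x; y; z] erefl) := h 1 _ erefl.
      by rewrite (sat_Eq nM) !tevalE.
    - move=> x y; have /sat_closeF/(_ [:: x; y] erefl) := h 2 _ erefl.
      by rewrite (sat_Eq nM) !tevalE.
    - move=> x y z; have /sat_closeF/(_ [:: x; y; z] erefl) := h 3 _ erefl.
      by rewrite (sat_Eq nM) !tevalE.
    - move=> x y z; have /sat_closeF/(_ [:: x; y; z] erefl) := h 4 _ erefl.
      by rewrite (sat_Eq nM) !tevalE.
  split=> // n b m.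
  have /sat_closeF/(_ [:: n; b; m] erefl) : sat e (closeF 3 (mainF C)).
    by apply: h; rewrite /=; tauto.
  by move/(sat_mainF nM facts).
move=> /= [<-|[<-|[<-|[<-|[<-|[<-|//]]]]]]; apply/sat_closeF.
- by case=> [|x [|y []]] // _; rewrite (sat_Eq nM) !tevalE; apply: (addC facts).
- by case=> [|x [|y [|z []]]] // _; rewrite (sat_Eq nM) !tevalE; apply: (addA facts).
- by case=> [|x [|y []]] // _; rewrite (sat_Eq nM) !tevalE; apply: (mulC facts).
- by case=> [|x [|y [|z []]]] // _; rewrite (sat_Eq nM) !tevalE; apply: (mulA facts).
- by case=> [|x [|y [|z []]]] // _; rewrite (sat_Eq nM) !tevalE; apply: (mulDl facts).
- by case=> [|n [|b [|m []]]] // _; apply/(sat_mainF nM facts); apply: h.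
Qed.

End ArithTheory.

Lemma models_Nat_Q : models Nat Q.
Proof.
move=> p Qp e; apply: (iffRL (sat_Q_axioms normal_Nat e)) Qp.
case: arith_facts_Nat => *; split=> // x; by case: x => // x _; exists x.
Qed.

Lemma models_Nat : models Nat Q_true_Pi1.
Proof. by move=> p [/models_Nat_Q//|[_ _ h]] e; apply/holds_Nat. Qed.

Lemma In_cat (A : Type) (x : A) s1 s2 : List.In x (s1 ++ s2) <-> List.In x s1 \/ List.In x s2.
Proof. exact: List.in_app_iff. Qed.

Lemma In_nth (A : Type) (d : A) s i : i < size s -> List.In (nth d s i) s.
Proof. by elim: s i => // x s IH [|i] /= h; [left|right; apply: IH]. Qed.

(** * From a set of numbers to a definable path *)

Section Core.
Variables (C : seq clause).

(** [X] may be any set of numbers, however complex: for given [n], only its part in [0, n] has to be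
    coded, and the literals that are tested have values in that interval. *)
Lemma true_coding_axioms (X : Nat -> Prop) :
  (forall c, List.In c C -> forall xs : seq Nat, size xs = c.1 ->
    exists l, List.In l c.2 /\ (X (lit_val xs l) <-> l.1)) ->
  forall p, List.In p (coding_axioms C) -> true_Pi1 p.
Proof.
move=> hX p hp; split.
- move: hp => /= [<-|[<-|[<-|[<-|[<-|[<-|//]]]]]]; exact: sentence_closeF.
- move: hp => /= [<-|[<-|[<-|[<-|[<-|[<-|//]]]]]]; apply: Pi1_closeF; try exact: Delta0_Eq.
  by apply: Delta0_Imp; [do !apply: Delta0_And; try apply: Delta0_Not; try apply: Delta0_Eq;
    apply: Delta0_Ball; apply: Delta0_And; apply: Delta0_dvdF
    | apply/Delta0_Bex/Delta0_goodF].
move=> e; apply/holds_Nat.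
move: p hp; apply/(sat_coding_axioms normal_Nat).
  by move=> p hp; apply: models_Nat_Q.
split; first exact: arith_facts_Nat.
move=> n b m [b0 [m0 h]].
pose Y : pred nat := fun k => if excluded_middle_informative (X k) then true else false.
have YX k : Y k <-> X k by rewrite /Y; case: excluded_middle_informative.
have hd j : j <= n -> j.+1 %| b /\ (j.+1 * b).+1 %| m.
  by move=> jn; have [|h1 h2] := h j; [apply/mle_Nat | split; apply/mdvd_Nat].
have [|j /hd[]//||j /hd[]//|a am ha] := @beta_code n b _ _ m Y.
- by rewrite lt0n; apply/eqP.
- by rewrite lt0n; apply/eqP.
exists a; split; first exact/mle_Nat.
move=> c Cc xs sx _ hl; have [l [cl Xl]] := hX c Cc xs sx; exists l; split=> //.
have ln := iffLR (mle_Nat _ _) (hl l cl).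
rewrite -Xl -YX -(ha _ ln); apply: mdvd_Nat.
Qed.

(** An instance of a clause with parameters in the cut has finitely many literals, whose values lie
    in the cut because it is closed under the operations. Some [n] in the cut exceeds them all, and
    a good code up to [n] that agrees with the path below [n] makes a literal true. *)
Theorem definable_path (X : Nat -> Prop) :
  (forall c, List.In c C -> forall xs : seq Nat, size xs = c.1 ->
    exists l, List.In l c.2 /\ (X (lit_val xs l) <-> l.1)) ->
  exists F : seq (form arith), (forall p, List.In p F -> true_Pi1 p) /\
  forall M : structure arith, normal M ->
    models M (finitely_axiomatised (Q_axioms ++ F)) ->
  exists K P : M -> Prop, [/\
    forall (e : nat -> M) x, sat e (KF C x) <-> K (e x),
    forall (e : nat -> M) x, sat e (pathF C x) <-> P (e x),
    forall (f : arith_fn) (xs : seq M), size xs = far (f : fn arith) ->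
      (forall x, List.In x xs -> K x) -> K (fnI (f : fn arith) xs) &
    forall c, List.In c C -> forall xs, size xs = c.1 -> (forall x, List.In x xs -> K x) ->
      exists l, List.In l c.2 /\ (P (lit_val xs l) <-> l.1)].
Proof.
move=> hX; exists (coding_axioms C); split; first exact: true_coding_axioms hX.
move=> M nM MA; pose e (_ : nat) : M := mzero.
have MQ p : List.In p Q_axioms -> sat e p.
  by move=> hp; apply: MA; apply/In_cat; left.
have MF p : List.In p (coding_axioms C) -> sat e p.
  by move=> hp; apply: MA; apply/In_cat; right.
have [facts main] := iffLR (sat_coding_axioms nM C MQ) MF.
pose g := @good M C.
have gm (n l a b : M) : mle n l -> g l a b -> g n a b.
  move=> nl h c Cc xs sx hx hl; apply: h => // [x /hx|l' /hl] h'; exact: mle_trans h' nl.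
have ge (n b m : M) : codes_room n b m -> exists a, g n a b.
  by move/main => [a [_ h]]; exists a.
have K0 := @cut_K_0 _ facts g.
have KI (f : arith_fn) (xs : seq M) : size xs = far (f : fn arith) ->
    (forall x, List.In x xs -> cut_K g x) -> cut_K g (fnI (f : fn arith) xs).
  case: f => /=.
  - by move/size0nil => -> _.
  - case: xs => [|x []] // _ h; apply: (cut_K_S facts); apply: h; by left.
  - case: xs => [|x [|y []]] // _ h; apply: (cut_K_add facts); apply: h; rewrite /=; tauto.
  - case: xs => [|x [|y []]] // _ h; apply: (cut_K_mul facts); apply: h; rewrite /=; tauto.
exists (cut_K g), (path g); split=> //.
- by move=> e' x; apply: sat_KF.
- by move=> e' x; apply: sat_pathF.
move=> c Cc xs sx Kx.
have Kl l : cut_K g (lit_val xs l).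
  rewrite /lit_val; elim/term_ffun_ind: l.2 => [i|f ts IH] /=.
    case: (ltnP i (size xs)) => h; last by rewrite nth_default.
    exact/Kx/In_nth.
  apply: (KI f); first by rewrite size_map size_enum_ord.
  by move=> x /List.in_map_iff[i [<- _]].
have [|n Kn hn] := @cut_K_bound _ facts g (xs ++ map (lit_val xs) c.2).
  by move=> x /In_cat[/Kx //|/List.in_map_iff[l [<- _]]].
have [a [b [gnab hp]]] := path_good facts gm ge Kn.
have hx x : List.In x xs -> mle x n.
  by move=> h; apply: (mltW facts); apply: hn; apply/In_cat; left.
have hl l : List.In l c.2 -> mle (msucc (lit_val xs l)) n.
  by move=> h; apply: hn; apply/In_cat; right; apply: List.in_map.
have [|l [cl hml]] := gnab c Cc xs sx hx; first by move=> l /hl/(mltW facts).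
by exists l; split=> //; rewrite -hp //; apply: hl.
Qed.

End Core.

(** * Henkin conditions as clauses *)

(** The polynomial (t + u)^2 + t + 1. It is a term of the language, so a cut closed under addition
    and multiplication is closed under it. The successor makes a pair exceed its components and
    differ from [tzero], which ends a list. *)
Definition pairt t u : term arith :=
  tsucc (tplus (ttimes (tplus t u) (tplus t u)) t).
Definition numt k : term arith := iter k tsucc tzero.
Definition codet k (ts : seq (term arith)) := pairt (numt k) (foldr pairt tzero ts).

Definition mpair (M : structure arith) (x y : M) : M :=
  msucc (madd (mmul (madd x y) (madd x y)) x).
Definition mcode (M : structure arith) k (xs : seq M) : M :=
  mpair (iter k (@msucc M) mzero) (foldr (@mpair M) mzero xs).

Lemma teval_codet (M : structure arith) (e : nat -> M) k ts :
  teval e (codet k ts) = mcode k (map (teval e) ts).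
Proof.
have pairE t u : teval e (pairt t u) = mpair (teval e t) (teval e u).
  by rewrite /pairt !tevalE.
rewrite /codet pairE /mcode; congr mpair.
  elim: k => [|k IH]; first exact: teval_zero.
  by rewrite [numt _]/(tsucc (numt k)) teval_succ IH.
elim: ts => [|t ts IH]; first exact: teval_zero.
by rewrite [foldr _ _ _]/(pairt t (foldr pairt tzero ts)) pairE IH.
Qed.

Section Clauses.
Variable S : signature.
Local Notation G := (graph_sig S).
Implicit Types (p q : form G).

Definition var_index (t : term G) : nat :=
  match t with Var x => x | App f _ => match f with end end.

Definition atom p (xs : seq nat) := codet (form_code p) (map Var xs).

(** The two directions of an equivalence. It refers each atomic subformula to one standard atom for
    its symbol, so that all occurrences of the symbol are governed by the same relation. *)
Definition link d p q xs : seq clause :=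
  [:: (d, [:: (false, atom p (iota 0 d)); (true, atom q xs)]);
      (d, [:: (true, atom p (iota 0 d)); (false, atom q xs)])].

Definition eq_atom : form G := Eq (Var 0) (Var 1).
Definition rl_atom (R : rl G) : form G := relv R (iota 0 (rar R)).

(* The witness for a false sentence [All p] with parameters [xs] is the number
   that codes this sentence. *)
Fixpoint henkin d p : seq clause :=
  match p with
  | Bot => [:: (d, [:: (false, atom Bot (iota 0 d))])]
  | Eq t u => link d (Eq t u) eq_atom [:: var_index t; var_index u]
  | Rel R ts => link d (Rel ts) (rl_atom R) [seq var_index (ts i) | i <- enum 'I_(rar R)]
  | Imp p q =>
      [:: (d, [:: (false, atom (Imp p q) (iota 0 d)); (false, atom p (iota 0 d));
                  (true, atom q (iota 0 d))]);
          (d, [:: (true, atom (Imp p q) (iota 0 d)); (true, atom p (iota 0 d))]);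
          (d, [:: (true, atom (Imp p q) (iota 0 d)); (false, atom q (iota 0 d))])]
      ++ henkin d p ++ henkin d q
  | All p =>
      [:: (d.+1, [:: (false, atom (All p) (iota 1 d)); (true, atom p (iota 0 d.+1))]);
          (d, [:: (true, atom (All p) (iota 0 d));
                  (false, codet (form_code p) (atom (All p) (iota 0 d) :: map Var (iota 0 d)))])]
      ++ henkin d.+1 p
  end.

Section Conditions.
Variables (M : structure arith) (K P : M -> Prop).
Implicit Types (xs : seq M).

Let T p xs := P (mcode (form_code p) xs).
Let in_K xs := forall x, List.In x xs -> K x.

Definition clause_holds (c : clause) := forall xs, size xs = c.1 -> in_K xs ->
  exists l, List.In l c.2 /\ (P (lit_val xs l) <-> l.1).

(** The clauses in readable form, relativised to [K], which is everything when their truth in the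
    standard model is verified and the cut when a model is built from the path. *)
Fixpoint conditions d p : Prop :=
  match p with
  | Bot => forall xs, size xs = d -> in_K xs -> ~ T Bot xs
  | Eq t u => forall xs, size xs = d -> in_K xs ->
      (T (Eq t u) xs <-> T eq_atom [:: nth mzero xs (var_index t); nth mzero xs (var_index u)])
  | Rel R ts => forall xs, size xs = d -> in_K xs ->
      (T (Rel ts) xs <->
       T (rl_atom R) [seq nth mzero xs (var_index (ts i)) | i <- enum 'I_(rar R)])
  | Imp p q => (forall xs, size xs = d -> in_K xs -> (T (Imp p q) xs <-> (T p xs -> T q xs))) /\
      conditions d p /\ conditions d q
  | All p => (forall y xs, size xs = d -> in_K (y :: xs) -> T (All p) xs -> T p (y :: xs)) /\
      (forall xs, size xs = d -> in_K xs ->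
         T p (mcode (form_code (All p)) xs :: xs) -> T (All p) xs) /\
      conditions d.+1 p
  end.

(** An explicit disjunction, on which propositional reasoning can work directly. *)
Fixpoint some_lit (xs : seq M) (ls : seq (bool * term arith)) : Prop :=
  if ls is l :: ls' then (if l.1 then P (lit_val xs l) else ~ P (lit_val xs l)) \/ some_lit xs ls'
  else False.

Lemma clause_holdsE c :
  clause_holds c <-> forall xs, size xs = c.1 -> in_K xs -> some_lit xs c.2.
Proof.
apply: forall_iff => xs; do 2!apply: imp_iff_compat_l.
elim: c.2 => [|[v t] ls IH] /=; first by split=> // -[l []].
rewrite -IH; split=> [[l [[<-|h1] h2]]|[h|[l [h1 h2]]]].
- by left; move: h2; case: v => /= -[h h']; [apply: h'|move/h].
- by right; exists l.
- by exists (v, t); split; [left|move: h; case: v => /= h; split=> // /h].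
- by exists l; split; [right|].
Qed.

Lemma lit_val_atom xs v p js :
  lit_val xs (v, atom p js) = mcode (form_code p) (map (nth mzero xs) js).
Proof. by rewrite /lit_val teval_codet -map_comp. Qed.

Lemma lit_val_atom_all xs v p :
  lit_val xs (v, atom p (iota 0 (size xs))) = mcode (form_code p) xs.
Proof. by rewrite lit_val_atom map_nth_iota0 // take_size. Qed.

Lemma clauses_cat C C' :
  (forall c, List.In c (C ++ C') -> clause_holds c) <->
  (forall c, List.In c C -> clause_holds c) /\ (forall c, List.In c C' -> clause_holds c).
Proof.
split=> [h|[h h'] c /In_cat[/h//|/h'//]].
by split=> c hc; apply: h; apply/In_cat; [left|right].
Qed.

Lemma clauses_link d p q js :
  (forall c, List.In c (link d p q js) -> clause_holds c) <->
  forall xs, size xs = d -> in_K xs -> (T p xs <-> T q (map (nth mzero xs) js)).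
Proof.
split=> h.
  move=> xs sx Kx; have h1 := iffLR (clause_holdsE _) (h _ (or_introl erefl)) xs sx Kx.
  have h2 := iffLR (clause_holdsE _) (h _ (or_intror (or_introl erefl))) xs sx Kx.
  move: h1 h2; rewrite /= -sx !lit_val_atom_all !lit_val_atom -/(T _ _) -/(T q _); tauto.
move=> c /= [<-|[<-|//]]; apply/clause_holdsE => xs /= sx Kx; have := h xs sx Kx;
  rewrite -sx !lit_val_atom_all !lit_val_atom -/(T p _) -/(T q _) => E;
  have := classic (T p xs); tauto.
Qed.

Lemma henkin_conditions d p :
  (forall c, List.In c (henkin d p) -> clause_holds c) <-> conditions d p.
Proof.
elim: p d => [|t u|R ts|p IHp q IHq|p IH] d.
- split=> [h xs sx Kx|h c /= [<-|//]].
    have := iffLR (clause_holdsE _) (h _ (or_introl erefl)) xs sx Kx.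
    by rewrite /= -sx lit_val_atom_all; tauto.
  apply/clause_holdsE => xs /= sx Kx; left.
  by rewrite -sx lit_val_atom_all; apply: h.
- exact: clauses_link.
- rewrite [henkin _ _]/= clauses_link /=.
  by do 3!apply: forall_iff => ?; rewrite -map_comp.
- apply: (iff_trans (clauses_cat _ _)); apply: and_iff_compat; last first.
    by rewrite clauses_cat IHp IHq.
  split=> h.
    move=> xs sx Kx; have h1 := iffLR (clause_holdsE _) (h _ (or_introl erefl)) xs sx Kx.
    have h2 := iffLR (clause_holdsE _) (h _ (or_intror (or_introl erefl))) xs sx Kx.
    have h3 := iffLR (clause_holdsE _) (h _ (or_intror (or_intror (or_introl erefl)))) xs sx Kx.
    move: h1 h2 h3; rewrite /= -sx !lit_val_atom_all -/(T p _) -/(T q _) -/(T (Imp p q) _).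
    by move: (T p xs) (T q xs) (T (Imp p q) xs) => A B D; tauto.
  move=> c /= [<-|[<-|[<-|//]]]; apply/clause_holdsE => xs /= sx Kx; have := h xs sx Kx;
    rewrite -sx !lit_val_atom_all -/(T p _) -/(T q _) -/(T (Imp p q) _);
    move: (T p xs) (T q xs) (T (Imp p q) xs) => A B D;
    have := classic A; have := classic B; tauto.
- apply: (iff_trans (clauses_cat _ _)); rewrite IH.
  apply: (iff_trans _ (and_assoc _ _ _)); apply: and_iff_compat_r.
  have tailE y xs : [seq nth mzero (y :: xs) i | i <- iota 1 (size xs)] = xs.
    by rewrite -[1]addn0 iotaDl -map_comp map_nth_iota0 // take_size.
  have witE xs v : lit_val xs (v, codet (form_code p)
      (atom (All p) (iota 0 (size xs)) :: map Var (iota 0 (size xs)))) =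
      mcode (form_code p) (mcode (form_code (All p)) xs :: xs).
    rewrite /lit_val teval_codet map_cons; congr (mcode _ (_ :: _)).
      exact: (lit_val_atom_all xs true (All p)).
    by rewrite -map_comp -[RHS]take_size -(map_nth_iota0 mzero).
  split=> h.
    split=> [y xs sx Kx hA|xs sx Kx hB]; subst d.
      have hA' : P (lit_val (y :: xs) (false, atom (All p) (iota 1 (size xs)))).
        by rewrite lit_val_atom tailE.
      rewrite /T -(lit_val_atom_all (y :: xs) true).
      by case: (iffLR (clause_holdsE _) (h _ (or_introl erefl)) (y :: xs) erefl Kx)
        => [/(_ hA')|[]].
    rewrite /T -(lit_val_atom_all xs true).
    case: (iffLR (clause_holdsE _) (h _ (or_intror (or_introl erefl))) xs erefl Kx) => //.
    by rewrite /= witE => -[/(_ hB)|].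
  move: h => [h1 h2] c /= [<-|[<-|//]]; apply/clause_holdsE => xs /= sx Kx.
    case: xs sx Kx => // y xs [sx] Kx; have [hA|hA] := classic (T (All p) xs).
      by right; left; rewrite -sx (lit_val_atom_all (y :: xs)); apply: h1.
    by left; rewrite -sx lit_val_atom tailE.
  have [hA|hA] := classic (T (All p) xs); first by left; rewrite -sx lit_val_atom_all.
  by right; left; rewrite -sx witE => hB; apply/hA/h2.
Qed.

End Conditions.

End Clauses.

(** * The Henkin structure on a cut *)

Section HenkinStructure.
Variables (S : signature) (M : structure arith) (K P : M -> Prop).
Local Notation G := (graph_sig S).

Definition henkin_structure : structure G := @Structure G {x | K x}
  (fun f => match f with end)
  (fun R xs => P (mcode (form_code (rl_atom R)) (map sval xs)))
  (fun x y => P (mcode (form_code (eq_atom S)) [:: sval x; sval y])).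

Hypothesis K_closed : forall (f : arith_fn) (xs : seq M), size xs = far (f : fn arith) ->
  (forall x, List.In x xs -> K x) -> K (fnI (f : fn arith) xs).

Lemma K_mcode k (xs : seq M) : (forall x, List.In x xs -> K x) -> K (mcode k xs).
Proof.
have Kz : K mzero by apply: K_closed.
have Ks x : K x -> K (msucc x) by move=> hx; apply: K_closed => // y [<-|[]].
have Ka x y : K x -> K y -> K (madd x y).
  by move=> hx hy; apply: K_closed => // z [<-|[<-|[]]].
have Km x y : K x -> K y -> K (mmul x y).
  by move=> hx hy; apply: K_closed => // z [<-|[<-|[]]].
have Kp x y : K x -> K y -> K (mpair x y).
  by move=> hx hy; apply/Ks/(Ka _ _ _ hx)/Km; apply: Ka.
move=> h; apply: (Kp _ _); first by elim: k => //= k IH; apply: Ks.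
elim: xs h => //= x xs IH h; apply: Kp; first by apply: h; left.
by apply: IH => y hy; apply: h; right.
Qed.

(** The truth lemma. Closure of [K] under the operations is used for [All p]: the witness is the
    code of [All p] with its parameters, a polynomial in elements of [K], and so belongs to the
    carrier. *)
Lemma sat_henkin_structure d (p : form G) (e : nat -> henkin_structure) :
  below d p -> conditions K P d p ->
  sat e p <-> P (mcode (form_code p) [seq sval (e i) | i <- iota 0 d]).
Proof.
have nthE e' n i : i < n ->
    nth mzero [seq sval ((e' : nat -> henkin_structure) j) | j <- iota 0 n] i = sval (e' i).
  by move=> lt; rewrite (nth_map 0) ?size_iota // nth_iota.
have Ke (e' : nat -> henkin_structure) n x :
    List.In x [seq sval (e' j) | j <- iota 0 n] -> K x.
  by move=> /List.in_map_iff[i [<- _]]; apply: svalP.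
have sz (e' : nat -> henkin_structure) n : size [seq sval (e' j) | j <- iota 0 n] = n.
  by rewrite size_map size_iota.
elim: p d e => [|[x|[]] [y|[]]|R ts|p IHp q IHq|p IH] d e.
- by move=> _ /(_ _ (sz e d) (@Ke _ _)) h; split.
- move=> /andP[xd yd] /(_ _ (sz e d) (@Ke _ _)) ->.
  by rewrite /= !nthE.
- move=> /forallP hts /(_ _ (sz e d) (@Ke _ _)) -> /=; rewrite -map_comp.
  set a := map _ _; set b := map _ _; suff -> : a = b by [].
  apply: eq_map => i /=; move: (hts i); case: (ts i) => [x|[]] /= xd.
  by rewrite nthE.
- move=> /andP[hp hq] [/(_ _ (sz e d) (@Ke _ _)) -> [cp cq]].
  by rewrite sat_Imp (IHp d) // (IHq d).
- move=> hp [h1 [h2 h3]].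
  have E y : sat (scons y e) p <->
      P (mcode (form_code p) (sval y :: [seq sval (e i) | i <- iota 0 d])).
    by rewrite (IH d.+1) //= -[1]addn0 iotaDl -map_comp.
  split=> [h|h y].
    apply: h2 => //; first exact: Ke.
    have Kc := @K_mcode (form_code (All p)) _ (@Ke e d).
    exact: (iffLR (E (exist _ _ Kc)) (h _)).
  apply/E/h1 => // x [<-|/Ke //].
  exact: svalP.
Qed.

End HenkinStructure.

(** * The truth of the clauses *)

Section Witness.
Variables (S : signature) (N : structure (graph_sig S)) (d0 : N).
Local Notation G := (graph_sig S).

(** The number (x + y)^2 + x lies from (x + y)^2 up to below the next square, so it determines x +
    y, and then x. *)
Lemma mpair_inj (x y x' y' : Nat) : mpair x y = mpair x' y' -> x = x' /\ y = y'.
Proof.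
rewrite /mpair /msucc /madd /mmul /= => -[h].
have lt a b a' b' : a + b < a' + b' -> (a + b) * (a + b) + a < (a' + b') * (a' + b') + a'.
  move=> lt; apply: (@leq_trans ((a + b).+1 * (a + b).+1)).
    rewrite mulSn mulnS addnA [X in _ <= X]addnC -addnS leq_add2l addSn ltnS.
    by rewrite -addnA leq_addr.
  by apply: leq_trans (leq_addr _ _); apply: leq_mul.
have s : x + y = x' + y'.
  by case: (ltngtP (x + y) (x' + y')) => // /lt; rewrite h ltnn.
move: h; rewrite s => /addnI xx; split=> //.
by move: s; rewrite xx => /addnI.
Qed.

Lemma iter_msucc k : iter k (@msucc Nat) mzero = k.
Proof. by elim: k => //= k ->. Qed.

Lemma mcode_inj k k' (xs xs' : seq Nat) : mcode k xs = mcode k' xs' -> k = k' /\ xs = xs'.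
Proof.
move=> /mpair_inj[]; rewrite !iter_msucc => -> h; split=> //.
elim: xs xs' h => [|x xs IH] [|x' xs'] //=.
by move=> /mpair_inj[-> /IH ->].
Qed.

Lemma mpair_gt (x y : Nat) : x < mpair x y /\ y < mpair x y.
Proof.
rewrite /mpair /msucc /madd /mmul /= !ltnS; split; first exact: leq_addl.
apply: (@leq_trans (x + y)); first exact: leq_addl.
by apply: leq_trans (leq_addr _ _); case: (x + y) => // n; rewrite leq_pmulr.
Qed.

(** Parameters are smaller than the code, which makes the recursion for the denotations of witnesses
    well founded. An index past the end is included: the default 0 is smaller too. *)
Lemma nth_lt_mcode k (xs : seq Nat) i : nth 0 xs i < mcode k xs.
Proof.
have h : nth 0 xs i <= foldr (@mpair Nat) mzero xs.
  elim: xs i => [|x xs IH] [|i] //=; first exact/ltnW/(mpair_gt _ _).1.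
  by apply: leq_trans (IH i) _; apply/ltnW/(mpair_gt _ _).2.
by apply: leq_ltn_trans h _; apply: (mpair_gt _ _).2.
Qed.

Definition counterexample (p : form G) (e : nat -> N) : N :=
  epsilon (inhabits d0) (fun y => ~ sat (scons y e) p).

Lemma counterexampleP p e : sat (scons (counterexample p e) e) p -> sat e (All p).
Proof.
move=> h x; apply: NNPP => nx.
exact: (epsilon_spec (inhabits d0) (fun y => ~ sat (scons y e) p) (ex_intro _ x nx)).
Qed.

(** [w] gives the element of [N] that a number denotes as a Henkin term: the code of [(All p, xs)]
    denotes a counterexample to [p] at the denotations of [xs] whenever there is one. The recursion
    is bounded by a depth [n], and [stable] shows that every depth above the number gives the same
    result. *)
Lemma witness_exists : exists w : nat -> N, forall p (xs : seq Nat),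
  w (mcode (form_code (All p)) xs) = counterexample p (fun i => w (nth 0 xs i)).
Proof.
pose is_code (k : nat) (c : form G * seq Nat) := k = mcode (form_code (All c.1)) c.2.
pose fix w n : nat -> N :=
  if n is n'.+1 then fun k =>
    match excluded_middle_informative (exists c, is_code k c) with
    | left H => let c := sval (constructive_indefinite_description _ H) in
        counterexample c.1 (fun i => w n' (nth 0 c.2 i))
    | right _ => d0
    end
  else fun _ => d0.
have stable m n k : k < m -> k < n -> w m k = w n k.
  elim: m n k => [|m IH] [|n] k //= km kn.
  case: excluded_middle_informative => // H.
  case: constructive_indefinite_description => c /= hc; congr counterexample.
  apply: functional_extensionality => i; apply: IH.
    by apply: leq_trans (km : k <= m); rewrite hc; apply: nth_lt_mcode.
  by apply: leq_trans (kn : k <= n); rewrite hc; apply: nth_lt_mcode.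
exists (fun k => w k.+1 k) => p xs; set k := mcode _ _; rewrite [w _ _]/=.
case: excluded_middle_informative => [H|[]]; last by exists (p, xs).
case: constructive_indefinite_description => -[q ys] /= h.
have [/form_code_inj[pq] xy] := mcode_inj h.
move: pq xy {h} => /= <- <-.
congr counterexample; apply: functional_extensionality => i.
exact: (@stable k (nth 0 xs i).+1 (nth 0 xs i) (nth_lt_mcode _ _ _) (ltnSn _)).
Qed.

(** [X] consists of the codes of pairs [(p, xs)] such that [p] is true in [N] of the elements
    denoted by [xs]. Injectivity of the coding turns membership into truth, and the choice of [w]
    gives the condition on witnesses. *)
Lemma true_conditions : exists X : Nat -> Prop,
  (forall d (p : form G), conditions (fun _ => True) X d p) /\
  forall (p : form G) (e : nat -> N), sentence p -> sat e p -> X (mcode (form_code p) [::]).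
Proof.
have [w hw] := witness_exists.
pose T p (xs : seq Nat) := sat (fun i => w (nth 0 xs i)) p.
pose X k := exists p xs, k = mcode (form_code p) xs /\ T p xs.
have XT p xs : X (mcode (form_code p) xs) <-> T p xs.
  by split=> [[q [ys [/mcode_inj[/form_code_inj -> ->]]]]|h] //; exists p, xs.
exists X; split; last first.
  move=> p e hp h; apply/XT; apply: (iffLR (sat_ext_below hp _)) h; by [].
move=> d p; elim: p d => [|[x|[]] [y|[]]|R ts|p IHp q IHq|p IH] d.
- by move=> xs _ _ /XT.
- by move=> xs _ _; rewrite !XT; apply: iff_refl.
- move=> xs _ _; rewrite !XT /T sat_relv ?size_iota //=.
  set a := map _ _; set b := map _ _; suff -> : a = b by [].
  have sa : size a = rar R by rewrite size_map size_enum_ord.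
  have sb : size b = rar R by rewrite size_map size_iota.
  apply: (@eq_from_nth _ d0); rewrite sa ?sb // => i lt.
  rewrite (nth_map (Ordinal lt)) ?size_enum_ord // (nth_map 0) ?size_iota //.
  rewrite nth_iota //= add0n (nth_map (Ordinal lt)) ?size_enum_ord //.
  by case: (ts _) => [x|[]].
- by split=> // xs _ _; rewrite !XT.
- have consE y xs : T p (y :: xs) <-> sat (scons (w y) (fun i => w (nth 0 xs i))) p.
    by apply: sat_ext => -[].
  split=> [y xs _ _|]; first by rewrite !XT consE; apply.
  split=> // xs _ _; rewrite !XT consE hw; exact: counterexampleP.
Qed.

End Witness.

Definition sentence_clauses (S : signature) (p : form (graph_sig S)) : seq clause :=
  (0, [:: (true, codet (form_code p) [::])]) :: henkin 0 p.

(** [N] certifies that the sentences in [F] are true in the standard model; the formulas for [K] and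
    [P] are written down from [p], uniformly in [M]. *)
Theorem henkin_interpretation (S : signature) (p : form (graph_sig S))
    (N : structure (graph_sig S)) (e : nat -> N) :
  sentence p -> sat e p ->
  exists F : seq (form arith), (forall q, List.In q F -> true_Pi1 q) /\
  forall M : structure arith, normal M ->
    models M (finitely_axiomatised (Q_axioms ++ F)) ->
  exists K P : M -> Prop, [/\
    forall (e : nat -> M) x, sat e (KF (sentence_clauses p) x) <-> K (e x),
    forall (e : nat -> M) x, sat e (pathF (sentence_clauses p) x) <-> P (e x),
    inhabited {x | K x} &
    forall e : nat -> henkin_structure S K P, sat e p].
Proof.
move=> hp hN; have [X [hX hXp]] := true_conditions (e 0).
have [|F [F_true hF]] := @definable_path (sentence_clauses p) X.
  move=> c /= [<-|hc] xs sx.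
    exists (true, codet (form_code p) [::]); split; first by left.
    by rewrite /lit_val teval_codet; split=> // _; apply: hXp hN.
  apply: (iffRL (henkin_conditions (fun _ => True) X 0 p) (hX 0 p) c hc xs sx).
  by [].
exists F; split=> // M nM MA; have [K [P [hK hP K_closed clauses]]] := hF M nM MA.
exists K, P; split=> //.
  by constructor; exists mzero; apply: K_closed.
move=> e'; apply/(sat_henkin_structure K_closed (d := 0)) => //.
  apply: (iffLR (henkin_conditions K P 0 p)) => c hc xs sx Kx.
  by apply: clauses => //; right.
have [|l [/= [<-|//]]] := clauses _ (or_introl erefl) [::] erefl; first by [].
by rewrite /lit_val teval_codet => h; apply/h.
Qed.

(** * Composition of translations *)

Lemma nth_block (A : Type) (d : A) (ss : seq (seq A)) x : x < size ss ->
  map (nth d (flatten ss)) (iota (sumn (map size (take x ss))) (size (nth [::] ss x))) =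
  nth [::] ss x.
Proof.
elim: ss x => // s ss IH [|x] /= lt.
  by rewrite map_nth_iota0 ?size_cat ?leq_addr // take_size_cat.
rewrite -[RHS]IH // iotaDl -map_comp; apply: eq_map => i /=.
by rewrite nth_cat ltnNge leq_addr /= addKn.
Qed.

Lemma map_ffun_nth (A : Type) (x0 : A) n (s : seq A) : size s = n ->
  [seq [ffun j : 'I_n => nth x0 s j] j | j <- enum 'I_n] = s.
Proof.
move=> sz; set l := LHS; have szl : size l = n by rewrite size_map size_enum_ord.
apply: (@eq_from_nth _ x0); rewrite szl ?sz // => i lt.
by rewrite (nth_map (Ordinal lt)) ?size_enum_ord // ffunE nth_enum_ord.
Qed.

(** Injectivity is not asked of [h], because identity is interpreted by a relation that [h]
    preserves in both directions. *)
Lemma sat_surjection (S : signature) (N N' : structure (graph_sig S)) (h : N -> N')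
    (e : nat -> N) p :
  (forall y, exists x, h x = y) ->
  (forall x y : N, eqI x y <-> eqI (h x) (h y)) ->
  (forall R (xs : seq N), size xs = rar R -> rlI R xs <-> rlI R (map h xs)) ->
  sat e p <-> sat (fun x => h (e x)) p.
Proof.
move=> surj hE hR; elim: p e => [|[x|[]] [y|[]]|R ts|p IHp q IHq|p IH] e //=.
- have sz : size [seq teval e (ts i) | i <- enum 'I_(rar R)] = rar R.
    by rewrite size_map size_enum_ord.
  suff <- : map h [seq teval e (ts i) | i <- enum 'I_(rar R)] =
    [seq teval (fun x => h (e x)) (ts i) | i <- enum 'I_(rar R)] by apply: hR.
  by rewrite -map_comp; apply: eq_map => i /=; case: (ts i) => [x|[]].
- by rewrite IHp IHq.
- have E x : sat (scons x e) p <-> sat (scons (h x) (fun x => h (e x))) p.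
    by rewrite IH; apply: sat_ext => -[].
  split=> H x; last exact/E.
  by have [y <-] := surj x; apply/E.
Qed.

Section Composition.
Variables (S A T : signature) (tau0 : translation A T).
Variables (domF eqF : form A) (rlF : rl (graph_sig S) -> form A).
Hypotheses (domF_below : below 1 domF) (eqF_below : below 2 eqF).
Hypothesis rlF_below : forall R, below (rar R) (rlF R).

(** The objects of a list occupy consecutive blocks of variables, in the order in which translated
    relations expect their arguments; the sum is the offset of block [x]. *)
Definition layout (ps : seq (piece tau0)) x : object tau0 :=
  (nth (piece0 tau0) ps x,
   iota (sumn (map (@dim _ _ tau0) (take x ps))) (dim (nth (piece0 tau0) ps x))).

Definition inner (q : form A) ps : form T := translate_open (layout ps) (unravel q).

Lemma below_inner q ps :
  below (size ps) q -> below (sumn (map (@dim _ _ tau0) ps)) (inner q ps).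
Proof.
move=> hq; apply: (below_translate (below_unravel hq)) => x lt /=.
rewrite size_iota; split=> //; apply/allP=> i; rewrite mem_iota => /andP[_ h].
apply: leq_trans h _; rewrite -{3}(cat_take_drop x ps) map_cat sumn_cat leq_add2l.
by rewrite (drop_nth (piece0 tau0)) //= leq_addr.
Qed.

Definition compose_dom i := And (dom i) (inner domF [:: i]).
Definition compose_eqt i j := inner eqF [:: i; j].
Definition compose_relt R (c : {ffun 'I_(rar R) -> piece tau0}) :=
  inner (rlF R) [seq c j | j <- enum 'I_(rar R)].

Lemma compose_dom_below i : below (dim i) (compose_dom i).
Proof.
rewrite below_And dom_below /=; have := @below_inner domF [:: i] domF_below.
by rewrite /= addn0.
Qed.

Lemma compose_eqt_below i j : below (dim i + dim j) (compose_eqt i j).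
Proof. by have := @below_inner eqF [:: i; j] eqF_below; rewrite /= addn0. Qed.

Lemma compose_relt_below R (c : {ffun 'I_(rar R) -> piece tau0}) :
  below (\sum_(j < rar R) dim (c j)) (@compose_relt R c).
Proof.
have := @below_inner (rlF R) [seq c j | j <- enum 'I_(rar R)].
rewrite size_map size_enum_ord sumnE 2!big_map big_enum /=; apply; exact: rlF_below.
Qed.

Definition compose : translation S T :=
  @Translation S T (piece tau0) (piece0 tau0) (@dim _ _ tau0) compose_dom compose_eqt
    compose_relt compose_dom_below compose_eqt_below compose_relt_below.

Variables (N : structure T) (d0 : N).
Variables (M : structure A) (nM : normal M).
Variables (pi : translated tau0 d0 -> M) (rep : M -> translated tau0 d0).
Hypothesis GM : graph_of pi rep.

Lemma sat_inner q (os : seq (translated tau0 d0)) (o0 : translated tau0 d0) :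
  below (size os) q ->
  sat (nth d0 (flatten [seq (sval o).2 | o <- os])) (inner q [seq (sval o).1 | o <- os]) <->
  sat (fun x => pi (nth o0 os x)) q.
Proof.
move=> hq; rewrite -(sat_unravel nM GM (nth o0 os)).
apply: sat_translate (below_unravel hq) _ => x lt; split.
  by rewrite /= (nth_map o0).
rewrite /= (nth_map o0) //.
have -> : [seq dim i | i <- take x [seq (sval o).1 | o <- os]] =
    [seq size i | i <- take x [seq (sval o).2 | o <- os]].
  rewrite -!map_take -!map_comp; apply: eq_map => o /=.
  by case: (svalP o).
have := @nth_block _ d0 [seq (sval o).2 | o <- os] x.
rewrite size_map (nth_map o0) // => /(_ lt).
case: (svalP (nth o0 os x)) => -> _.
by rewrite -!map_take -!map_comp.
Qed.

Variables (B : structure (graph_sig S)) (v : B -> M).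
Hypothesis v_inj : injective v.
Hypothesis dom_v : forall (e : nat -> M), sat e domF <-> exists b, v b = e 0.
Hypothesis eq_v : forall (e : nat -> M) b b', e 0 = v b -> e 1 = v b' ->
  sat e eqF <-> eqI b b'.
Hypothesis rl_v : forall R (e : nat -> M) bs, size bs = rar R ->
  map e (iota 0 (rar R)) = map v bs -> sat e (rlF R) <-> rlI R bs.

Lemma compose_dom_v (o : piece tau0 * seq N) :
  size o.2 = dim o.1 /\ sat (nth d0 o.2) (compose_dom o.1) <->
  exists o' b, sval (o' : translated tau0 d0) = o /\ v b = pi o'.
Proof.
have E (o' : translated tau0 d0) : sat (nth d0 (sval o').2) (inner domF [:: (sval o').1]) <->
    exists b, v b = pi o'.
  have := @sat_inner domF [:: o'] o' domF_below; rewrite /= cats0 => ->.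
  exact: dom_v.
rewrite sat_And; split=> [[sz [hd hi]]|[o' [b [<- vb]]]].
  pose o' : translated tau0 d0 := exist _ o (conj sz hd).
  by have [b vb] := iffLR (E o') hi; exists o', b.
by case: (svalP o') => sz hd; split=> //; split=> //; apply/E; exists b.
Qed.

(** [h] sends a tuple to the element of [B] whose image under [v] is the class of that tuple in [M].
    It is onto because every element of [M] has a representing tuple, and it preserves the relations
    by the assumptions on [eqF] and [rlF]. *)
Lemma sat_compose (o0 : translated tau0 d0) :
  exists h : translated compose d0 -> B,
    (forall b, exists o, h o = b) /\
    forall p e, sat e p <-> sat (fun x => h (e x)) p.
Proof.
have lift_ex (o : translated compose d0) : {ob : translated tau0 d0 * B |
    sval ob.1 = sval o /\ v ob.2 = pi ob.1}.
  apply: constructive_indefinite_description.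
  by have [o' [b [h1 h2]]] := iffLR (compose_dom_v _) (svalP o); exists (o', b).
pose lift o := (sval (lift_ex o)).1; pose h o := (sval (lift_ex o)).2.
have liftE o : sval (lift o) = sval o by case: (svalP (lift_ex o)).
have vh o : v (h o) = pi (lift o) by case: (svalP (lift_ex o)).
have surj b : exists o, h o = b.
  pose o' := rep (v b); have bo' : v b = pi o' by rewrite (graph_cancel GM).
  have ho := iffRL (compose_dom_v (sval o')) (ex_intro _ o' (ex_intro _ b (conj erefl bo'))).
  exists (exist _ (sval o') ho : translated compose d0); apply: v_inj; rewrite vh bo'.
  congr pi; apply: eq_sig_hprop => [x ? ?|]; first exact: proof_irrelevance.
  by rewrite liftE.
exists h; split=> // p e; apply: sat_surjection => // [x y|R os sz].
  have := @sat_inner eqF [:: lift x; lift y] o0 eqF_below.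
  by rewrite /= !liftE cats0 => ->; apply: eq_v; rewrite vh.
have lo (X : Type) (F : piece tau0 * seq N -> X) :
    [seq F (sval o) | o <- map lift os] = [seq F (sval o) | o <- os].
  by rewrite -map_comp; apply: eq_map => o /=; rewrite liftE.
have szl : size (map lift os) = rar R by rewrite size_map.
have := @sat_inner (rlF R) (map lift os) o0; rewrite szl => /(_ (rlF_below R)).
rewrite (lo _ snd) (lo _ fst) /= /compose_relt map_ffun_nth ?size_map // => ->.
apply: rl_v; first by rewrite size_map.
transitivity (map pi (map (nth o0 (map lift os)) (iota 0 (rar R)))).
  by rewrite -[RHS]map_comp.
rewrite map_nth_iota0 ?szl // take_oversize ?szl //.
by rewrite -[LHS]map_comp -[RHS]map_comp; apply: eq_map => o /=; rewrite vh.
Qed.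

End Composition.

(** * Polyglot theories *)

Lemma tbelow_args n m (ts : seq (term arith)) : size ts = m -> all (tbelow n) ts ->
  [forall i : 'I_m, tbelow n ([ffun i : 'I_m => nth (Var 0) ts (val i)] i)].
Proof.
move=> sz /(all_nthP (Var 0)) h; apply/forallP=> i; rewrite ffunE.
by apply: h; rewrite sz; apply: ltn_ord.
Qed.

Lemma is_theory_Q : is_theory Q.
Proof.
by move=> p; case=> [<-|[<-|[<-|[<-|[<-|[<-|[<-|//]]]]]]]; rewrite /sentence /= ?andbT;
  repeat ((apply/andP; split=> //) || (apply: tbelow_args => //=)).
Qed.

Lemma proves_And (S : signature) (W : theory S) p q :
  proves W p -> proves W q -> proves W (And p q).
Proof.
move=> hp hq; apply: proves_impI; apply: (proves_impE (p := q)).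
  apply: (proves_impE (p := p)); first by apply: proves_ax; right.
  by apply: proves_mono hp => r; left.
by apply: proves_mono hq => r; left.
Qed.

Lemma proves_bigAnd (S : signature) (A : seq (form S)) :
  proves (finitely_axiomatised A) (bigAnd A).
Proof.
suff h B : (forall p, List.In p B -> List.In p A) -> proves (finitely_axiomatised A) (bigAnd B).
  exact: h.
elim: B => [|p B IH] h.
  by exists [::] => //; apply: d_impI; apply: d_ax; left.
apply: proves_And; first by apply: proves_ax; apply: h; left.
by apply: IH => q hq; apply: h; right.
Qed.

Lemma sentence_bigAnd (S : signature) (A : seq (form S)) :
  is_theory (finitely_axiomatised A) -> sentence (bigAnd A).
Proof.
move=> hA; rewrite /sentence below_bigAnd.
elim: A hA => //= p A IH hA; apply/andP; split; first by apply: hA; left.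
by apply: IH => q hq; apply: hA; right.
Qed.

Definition graph_axioms (S : signature) (A : seq (form S)) :=
  And (identity_axioms S) (unravel (bigAnd A)).

Lemma sentence_graph_axioms (S : signature) (A : seq (form S)) :
  is_theory (finitely_axiomatised A) -> sentence (graph_axioms A).
Proof.
move=> hA; rewrite /sentence /graph_axioms below_And [below 0 _]sentence_identity_axioms.
exact/below_unravel/sentence_bigAnd.
Qed.

Lemma polyglot_tolerates (T : signature) (U : theory T) :
  polyglot U -> locally_tolerates U Q_true_Pi1.
Proof.
move=> poly A hA AQ.
have con : consistent (finitely_axiomatised A).
  move=> h; apply: (proves_sound (fun _ => 0 : Nat) normal_Nat _ h) => p Ap e.
  exact: proves_sound e normal_Nat models_Nat (AQ p Ap).
have [B [[_ [tau [h1 h2]]] conB]] := poly arith A hA con.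
exists tau => h; apply: conB; apply: proves_impE.
  by apply: proves_mono (proves_impI h) => p; left.
apply: proves_And; first exact: h1.
by apply: h2; [apply: sentence_bigAnd|apply: proves_bigAnd].
Qed.

Lemma graph_axioms_graph_of (S : signature) (A : seq (form S)) (G : structure (graph_sig S))
    (e : nat -> G) :
  is_theory (finitely_axiomatised A) -> sat e (graph_axioms A) ->
  exists (M : structure S) (pi : G -> M) (rep : M -> G),
    [/\ normal M, graph_of pi rep & models M (finitely_axiomatised A)].
Proof.
move=> hA /sat_And[/sat_identity_axioms/graph_of_exists[M [pi [rep [nM GM]]]]].
move=> /(sat_unravel nM GM)/sat_bigAnd h; exists M, pi, rep; split=> //.
exact: models_sentences hA h.
Qed.

Lemma translated_point (S T : signature) (tau : translation S T) (A : seq (form S))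
    (N : structure T) (e : nat -> N) :
  sat e (translate tau (graph_axioms A)) -> inhabited (translated tau (e 0)).
Proof.
(* Translation commutes with [And] by computation, and the pattern extracts the fourth identity
   axiom, [Ex (eqv S 0 0)]. *)
move=> /sat_And[/sat_And[_ /sat_And[_ /sat_And[_ /sat_And[h _]]]] _].
exact: (@translate_Ex_inhabited _ _ tau _ (e 0) e _ (eqv S 0 0) h).
Qed.

(** * The interpretation obtained from translated arithmetic *)

Section Interpretation.
Variables (S T : signature) (A : seq (form S)) (tau0 : translation arith T).
Local Notation C := (sentence_clauses (graph_axioms A)).

Definition member (p : form (graph_sig S)) k :=
  subst (only k) (subst0 (atom p (iota 0 k)) (pathF C 0)).
Definition domain := subst (only 1) (KF C 0).

Definition henkin_translation : translation S T :=
  @compose S arith T tau0 domain (member (eq_atom S) 2) (fun R => member (rl_atom R) (rar R))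
    (below_only _ _) (below_only _ _) (fun R => below_only _ _).

Variables (F : seq (form arith)) (N : structure T) (e : nat -> N).
Hypothesis hF : is_theory (finitely_axiomatised (Q_axioms ++ F)).
Hypothesis F_interprets : forall M : structure arith, normal M ->
    models M (finitely_axiomatised (Q_axioms ++ F)) ->
  exists K P : M -> Prop, [/\
    forall (e : nat -> M) x, sat e (KF C x) <-> K (e x),
    forall (e : nat -> M) x, sat e (pathF C x) <-> P (e x),
    inhabited {x | K x} &
    forall e : nat -> henkin_structure S K P, sat e (graph_axioms A)].

(** The translation is fixed before the model [N] is considered, as the completeness theorem
    requires. The structure that [tau0] defines in [N] has a normal quotient [M]; the Henkin
    structure on the cut of [M] is definable there, and composition carries the truth of the axioms
    back to [N]. *)
Lemma sat_henkin_translation :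
  sat e (translate tau0 (graph_axioms (Q_axioms ++ F))) ->
  exists rho : nat -> translated henkin_translation (e 0), sat rho (graph_axioms A).
Proof.
move=> h; have [o0] := translated_point h.
pose rho0 (_ : nat) : translated tau0 (e 0) := o0.
have {h} h : sat rho0 (graph_axioms (Q_axioms ++ F)).
  by apply: (iffLR (sat_translate (sentence_graph_axioms hF) _)) h.
have [M [pi [rep [nM GM MQF]]]] := graph_axioms_graph_of hF h.
have [K [P [hK hP [b0] hB]]] := F_interprets nM MQF.
have onlyE (e' : nat -> M) k i : i < k -> teval e' (only k i) = e' i.
  by rewrite /only => ->.
have memberE p k (e' : nat -> M) :
    sat e' (member p k) <-> P (mcode (form_code p) (map e' (iota 0 k))).
  have E t : sat (fun i => teval e' (only k i)) (subst0 t (pathF C 0)) <->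
      P (teval (fun i => teval e' (only k i)) t) by rewrite sat_subst0; apply: hP.
  rewrite sat_subst E teval_codet -map_comp.
  suff -> : map e' (iota 0 k) = [seq teval e' (only k i) | i <- iota 0 k] by [].
  by apply/eq_in_map => i; rewrite mem_iota add0n => /= /onlyE ->.
pose v (b : henkin_structure S K P) := sval b.
have v_inj : injective v.
  by move=> b b' bb'; apply: eq_sig_hprop => // x ? ?; apply: proof_irrelevance.
have [|||f [surj hx]] := @sat_compose S arith T tau0 domain (member (eq_atom S) 2)
  (fun R => member (rl_atom R) (rar R)) (below_only _ _) (below_only _ _)
  (fun R => below_only _ _) N (e 0) M nM pi rep GM (henkin_structure S K P) v v_inj _ _ _ o0.
- move=> e'; rewrite sat_subst hK /=.
  by split=> [k|[b <-]]; [exists (exist _ _ k) | apply: svalP].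
- by move=> e' b b' h0 h1; rewrite memberE /= h0 h1.
- by move=> R e' bs sz; rewrite memberE => ->.
have [o _] := surj b0.
by exists (fun _ => o); apply/hx.
Qed.

End Interpretation.

Lemma tolerates_polyglot (T : signature) (U : theory T) :
  is_theory U -> locally_tolerates U Q_true_Pi1 -> polyglot U.
Proof.
move=> hU tol S A hA conA.
have [N [e [nN NA]]] := model_existence (bounded_is_theory hA) conA.
have GN := graph_of_graph_structure N.
have hg : @sat _ (graph_structure N) e (graph_axioms A).
  apply/sat_And; split; first by apply/sat_identity_axioms/(graph_of_identity_facts GN).
  by apply/(sat_unravel nN GN)/sat_bigAnd.
have [F [F_true F_int]] := henkin_interpretation (sentence_graph_axioms hA) hg.
have hF : is_theory (finitely_axiomatised (Q_axioms ++ F)).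
  by move=> p /In_cat[/is_theory_Q|/F_true[]].
have [|tau0 con] := tol (Q_axioms ++ F) hF.
  by move=> p /In_cat[hp|hp]; apply: proves_ax; [left|right; apply: F_true].
(* The pro-interpreter is the translated arithmetic itself; its consistency with [U] is exactly what
   tolerance provides. *)
set B := translate tau0 _ in con; have hB : sentence B.
  exact/sentence_translate/(sentence_graph_axioms hF).
have hUB : is_theory (extend U B) by move=> p [/hU|->].
exists B; split=> //; split=> //.
have key (M : structure T) (e' : nat -> M) : models M (extend U B) ->
    exists rho : nat -> translated (henkin_translation A tau0) (e' 0), sat rho (graph_axioms A).
  by move=> MB; apply: (sat_henkin_translation hF F_int); apply: MB; right.
have sentE (M : structure T) (e' : nat -> M) rho p : sentence p ->
    @sat _ (translated (henkin_translation A tau0) (e' 0)) rho p ->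
    sat e' (translate (henkin_translation A tau0) p).
  by move=> hp hs; apply: (iffRL (sat_translate (rho := rho) hp _)).
exists (henkin_translation A tau0); split=> [|p hp Ap]; apply: completeness => // M nM MB e'.
  have [rho /sat_And[h _]] := key M e' MB.
  by apply: sentE h; apply: sentence_identity_axioms.
have [rho h] := key M e' MB.
have [M' [pi [rep [nM' GM' MA]]]] := graph_axioms_graph_of hA h.
apply: (sentE _ _ rho); first exact: below_unravel.
by apply/(sat_unravel nM' GM'); apply: proves_sound Ap.
Qed.

Theorem theorem2p7 (T : signature) (U : theory T) (hU : is_theory U) :
  polyglot U <-> locally_tolerates U Q_true_Pi1.
Proof. by split; [apply: polyglot_tolerates | apply: tolerates_polyglot]. Qed.
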